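(* Let $M=\mathbb S^2\times\mathbb S^1$ and let $\{g_i\}_{i\in\mathbb N}$ be a sequence of smooth Riemannian metrics on $M$ of the form $g_i=\varphi_i^{-2}h_i+\varphi_i^2d\xi^2$, $h_i=dr^2+u_i^2(r)d\theta^2$ with $r\in[0,2]$ for all $i$ (see context), satisfying for constants $V_0,A_0>0$ independent of $i$: $\mathrm{Scalar}_{g_i}\ge0$, $\mathrm{Vol}_{g_i}(M)\le V_0$, $\mathrm{MinA}(M,g_i)\ge A_0$. Pass to a subsequence with limit functions $u_\infty,\varphi_\infty$ as described in the context, and set $$g_\infty=\varphi_\infty^{-2}\bigl(dr^2+u_\infty^2d\theta^2\bigr)+\varphi_\infty^2d\xi^2\quad\text{on }\mathring M=\{0<r<2\}\times\mathbb S^1_\theta\times\mathbb S^1_\xi .$$ Then along this subsequence, for every $1\le p<\infty$, $$g_i\to g_\infty\quad\text{in }L^p(M,g_0)$$ as symmetric $2$-tensors, where $g_0$ is the standard product metric on $\mathbb S^2\times\mathbb S^1$. Moreover, for every $0<\epsilon<1$, on $M_\epsilon:=\Omega_\epsilon\times\mathbb S^1$, where $\Omega_\epsilon=\{(r,\theta)\mid\epsilon\le r\le2-\epsilon,\ 0\le\theta\le2\pi\}$, the coefficients of $g_i$ converge uniformly to those of $g_\infty$.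
   Context: Metric form: $g_i=\varphi_i^{-2}h_i+\varphi_i^2d\xi^2$ with $\xi\in[0,2\pi]$ the coordinate on $\mathbb S^1$, $\varphi_i\in C^\infty(\mathbb S^2)$, $\varphi_i>0$ (a function of $(r,\theta)$, independent of $\xi$), and $h_i=dr^2+u_i^2(r)d\theta^2$, $r\in[0,2]$, $\theta\in[0,2\pi]$, a smooth rotationally symmetric metric on $\mathbb S^2$; here $u_i\in C^\infty([0,2])$, $u_i>0$ on $(0,2)$, $u_i(0)=u_i(2)=0$, $u_i'(0)=1$, $u_i'(2)=-1$. $\mathrm{MinA}(M,g):=\inf\{\mathrm{Area}_g(\Sigma)\mid \Sigma\text{ is a closed minimal surface in }(M,g)\}$. Limit functions: under these hypotheses, after passing to a subsequence, $u_i\to u_\infty$ uniformly on $[0,2]$, and there is a positive function $\varphi_\infty$ on $(0,2)\times[0,2\pi]$ such that $\varphi_i\to\varphi_\infty$ in $C^{0,\alpha}(\Omega_\epsilon)$ for all $\alpha<1/2$ and $0<\epsilon<1$, and $\varphi_i\to\varphi_\infty$ in $L^p(\mathbb S^2)$ for all $1\le p<\infty$. $g_\infty$ is regarded as a measurable symmetric $2$-tensor on $M$ ($M\setminus\mathring M$ has measure zero). The standard product metric is written, in coordinates with poles at $r=0,2$, as $g_0=dr^2+\frac{4}{\pi^2}\sin^2\!\big(\frac{\pi r}{2}\big)d\theta^2+d\xi^2$. *)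

(* Defs.v *)
From HB Require Import structures.
From mathcomp Require Import all_boot all_order all_algebra.
From mathcomp Require Import all_classical all_reals all_analysis.

Set Implicit Arguments.
Unset Strict Implicit.
Unset Printing Implicit Defensive.

Import Order.TTheory GRing.Theory Num.Theory.
Import numFieldNormedType.Exports.

Local Open Scope classical_set_scope.
Local Open Scope ring_scope.

(* C^k on an open set U: derivatives in all directions (rather than only along
   a basis) exist and are C^(k-1); in finite dimension this is the usual
   notion. *)
Fixpoint Ck (R : realType) (V W : normedModType R) (k : nat) (U : set V)
    (f : V -> W) : Prop :=
  (forall x, U x -> {for x, continuous f}) /\
  match k with
  | 0 => True
  | k'.+1 => forall v : V,
      (forall x, U x -> derivable f x v) /\ Ck k' U (fun x => 'D_v f x)
  end.

Definition smooth (R : realType) (V W : normedModType R) (U : set V)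
    (f : V -> W) : Prop := forall k, Ck k U f.

Section Coordinates.
Variable R : realType.

Definition vec3 (a b c : R) : 'rV[R]_3 := \row_j [:: a; b; c]`_j.

Definition basis3 (a : 'I_3) : 'rV[R]_3 := delta_mx 0 a.

Definition partial (a : 'I_3) (f : 'rV[R]_3 -> R) (x : 'rV[R]_3) : R :=
  'D_(basis3 a) f x.

End Coordinates.

(** * Riemannian geometry of a coordinate expression of a metric *)

Section LocalGeometry.
Variables (R : realType) (G : 'rV[R]_3 -> 'M[R]_3).
Implicit Types (x : 'rV[R]_3) (i j k : 'I_3).

Definition inner x (v w : 'rV[R]_3) : R := (v *m G x *m w^T) 0 0.

Definition inverse_metric x : 'M[R]_3 := invmx (G x).

(* christoffel k i j is $\Gamma^k_{ij}$ *)
Definition christoffel k i j x : R :=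
  2^-1 * \sum_l inverse_metric x k l *
    (partial i (fun y => G y j l) x + partial j (fun y => G y i l) x
     - partial l (fun y => G y i j) x).

Definition ricci i j x : R :=
  \sum_k (partial k (christoffel k i j) x - partial j (christoffel k i k) x)
  + \sum_k \sum_l (christoffel k k l x * christoffel l i j x
                   - christoffel k j l x * christoffel l i k x).

Definition scalar_curvature x : R :=
  \sum_i \sum_j inverse_metric x i j * ricci i j x.

Definition volume_density x : R := Num.sqrt (\det (G x)).

Definition gradient (F : 'rV[R]_3 -> R) x : 'rV[R]_3 :=
  \row_a \sum_b inverse_metric x a b * partial b F x.

Definition unit_normal (F : 'rV[R]_3 -> R) x : 'rV[R]_3 :=
  (Num.sqrt (inner x (gradient F x) (gradient F x)))^-1 *: gradient F x.

(* Mean curvature, at x, of the level set of F through x: the trace of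
   $X \mapsto \nabla_X \nu$, where $\nu$ is the unit normal.  Taking the trace
   over the whole tangent space of M or over that of the level set is the same,
   since $\nu$ has unit length near x and so $g(\nabla_\nu \nu, \nu) = 0$. *)
Definition mean_curvature (F : 'rV[R]_3 -> R) x : R :=
  \sum_a (partial a (fun y => unit_normal F y 0 a) x
          + \sum_b christoffel a a b x * unit_normal F x 0 b).

(* Area density of the pull-back of the metric by a parametrization f. *)
Definition area_density (f : R * R -> 'rV[R]_3) (s : R * R) : R :=
  let f1 := 'D_((1, 0) : R * R) f s in
  let f2 := 'D_((0, 1) : R * R) f s in
  Num.sqrt (inner (f s) f1 f1 * inner (f s) f2 f2 - inner (f s) f1 f2 ^+ 2).

(* Pointwise norm $|T|_g$ of a 2-tensor:
   $|T|_g^2 = g^{ac} g^{bd} T_{ab} T_{cd}$ *)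
Definition tensor_norm (T : 'rV[R]_3 -> 'M[R]_3) x : R :=
  Num.sqrt (\sum_a \sum_b \sum_c \sum_d
    inverse_metric x a c * inverse_metric x b d * T x a b * T x c d).

End LocalGeometry.

(** * The manifold S^2 x S^1 *)

(* S^2 x S^1 is the set of pairs of unit vectors of R^3 and R^2.  It is covered
   by three families of coordinates: the polar ones (r, theta, xi), with
   0 < r < 2, and for each of the poles r = 0 and r = 2 the Cartesian ones
   (s cos theta, s sin theta, xi), where s < 2 is the distance to that pole,
   that is s = r, respectively s = 2 - r.  The angles range over R: coordinates
   need not be injective, they are local diffeomorphisms. *)
Inductive chart := Polar | North | South.

Section Manifold.
Variable R : realType.

Definition disk_domain (c : chart) : set (R * R) :=
  match c with
  | Polar => [set y | 0 < y.1 < 2]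
  | _ => [set y | y.1 ^+ 2 + y.2 ^+ 2 < 4]
  end.

(* At the origin of North and South, s^-1 = 0 and the result is the pole. *)
Definition sphere_point (c : chart) (y : R * R) : R * R * R :=
  let s := Num.sqrt (y.1 ^+ 2 + y.2 ^+ 2) in
  let q := sin (pi * s / 2) / s in
  match c with
  | Polar => (sin (pi * y.1 / 2) * cos y.2, sin (pi * y.1 / 2) * sin y.2,
              cos (pi * y.1 / 2))
  | North => (q * y.1, q * y.2, cos (pi * s / 2))
  | South => (q * y.1, q * y.2, - cos (pi * s / 2))
  end.

Definition sphere : set (R * R * R) :=
  [set p | p.1.1 ^+ 2 + p.1.2 ^+ 2 + p.2 ^+ 2 = 1].

Definition circle : set (R * R) := [set q | q.1 ^+ 2 + q.2 ^+ 2 = 1].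

Definition manifold : set ((R * R * R) * (R * R)) := sphere `*` circle.

Definition chart_domain (c : chart) : set 'rV[R]_3 :=
  [set x | disk_domain c (x 0 0, x 0 1)].

Definition chart_point (c : chart) (x : 'rV[R]_3) : (R * R * R) * (R * R) :=
  (sphere_point c (x 0 0, x 0 1), (cos (x 0 2), sin (x 0 2))).

(* f is a function on the sphere; its values elsewhere are irrelevant. *)
Definition smooth_on_sphere (f : R * R * R -> R) : Prop :=
  forall c, smooth (disk_domain c) (fun y => f (sphere_point c y)).

(* A 2-tensor on the manifold, given by its components in each chart;
   the values outside of the domain of the chart are irrelevant. *)
Definition tensor_field := chart -> 'rV[R]_3 -> 'M[R]_3.

Record riemannian_metric (g : tensor_field) : Prop := RiemannianMetric {
  metric_smooth : forall c a b, smooth (chart_domain c) (fun x => g c x a b) ;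
  metric_sym : forall c x, chart_domain c x -> (g c x)^T = g c x ;
  metric_pos : forall c x (v : 'rV[R]_3),
    chart_domain c x -> v != 0 -> 0 < inner (g c) x v v ;
  (* tensoriality under any smooth local change of coordinates t; 'J t x is the
     transpose of the usual Jacobian matrix *)
  metric_compat : forall c c' (t : 'rV[R]_3 -> 'rV[R]_3) (U : set 'rV[R]_3),
    open U -> U `<=` chart_domain c -> smooth U t ->
    (forall x, U x ->
       chart_domain c' (t x) /\ chart_point c' (t x) = chart_point c x) ->
    forall x, U x -> g c x = 'J t x *m g c' (t x) *m ('J t x)^T }.

Definition nonneg_scalar_curvature (g : tensor_field) : Prop :=
  forall c x, chart_domain c x -> 0 <= scalar_curvature (g c) x.

(** * Integration *)

Local Notation mR := (measurableTypeR R).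

Definition leb2 : {measure set (mR * mR) -> \bar R} :=
  (@lebesgue_measure R \x @lebesgue_measure R)%E.

Definition leb3 : {measure set (mR * mR * mR) -> \bar R} :=
  ((@lebesgue_measure R \x @lebesgue_measure R) \x @lebesgue_measure R)%E.

(* The polar coordinates (r, theta), resp. (r, theta, xi), with angles in
   [0, 2 pi]: they parametrize the sphere, resp. the manifold, up to null
   sets. *)
Definition polar_box2 : set (R * R) :=
  `]0, 2[%classic `*` `[0, 2 * pi]%classic.

Definition polar_box3 : set (R * R * R) :=
  polar_box2 `*` `[0, 2 * pi]%classic.

Definition coord3 (y : R * R * R) : 'rV[R]_3 := vec3 y.1.1 y.1.2 y.2.

Definition volume (g : tensor_field) : \bar R :=
  \int[leb3]_(y in polar_box3) (volume_density (g Polar) (coord3 y))%:E.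

(** * Minimal surfaces *)

(* Near each of its points, S is a regular level set, of zero mean curvature,
   of a smooth function F (so S is an embedded surface without boundary). *)
Definition closed_minimal_surface (g : tensor_field)
    (S : set ((R * R * R) * (R * R))) : Prop :=
  [/\ S !=set0, S `<=` manifold, compact S &
   forall p, S p ->
   exists (c : chart) (V : set 'rV[R]_3) (F : 'rV[R]_3 -> R),
   [/\ [/\ open V, V `<=` chart_domain c & (chart_point c @` V) p],
       smooth V F,
       forall x, V x -> exists a, partial a F x != 0,
       forall x, V x -> (S (chart_point c x) <-> F x = 0) &
       forall x, V x -> F x = 0 -> mean_curvature (g c) F x = 0]].

(* a is the area of S: S is partitioned into finitely many pieces, the k-th of
   which is parametrized, bijectively, by the Borel set B k via f k.  By the
   change of variables formula, a does not depend on the partition. *)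
Definition has_area (g : tensor_field) (S : set ((R * R * R) * (R * R)))
    (a : \bar R) : Prop :=
  exists (n : nat) (c : 'I_n -> chart) (f : 'I_n -> R * R -> 'rV[R]_3)
    (U B : 'I_n -> set (R * R)),
  [/\ forall k, [/\ open (U k), measurable (B k : set (mR * mR)), B k `<=` U k,
        smooth (U k) (f k) & forall s, U k s -> chart_domain (c k) (f k s)],
      forall k l s t, B k s -> B l t ->
        chart_point (c k) (f k s) = chart_point (c l) (f l t) -> k = l /\ s = t,
      S = \bigcup_k [set chart_point (c k) (f k s) | s in B k] &
      a = (\sum_(k < n)
             \int[leb2]_(s in B k) (area_density (g (c k)) (f k) s)%:E)%E].

Definition MinA (g : tensor_field) : \bar R :=
  ereal_inf [set a | exists S, closed_minimal_surface g S /\ has_area g S a].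

(** * Warped metrics *)

(* $\varphi^{-2} (dr^2 + u^2 d\theta^2) + \varphi^2 d\xi^2$ in the coordinates
   (r, theta, xi) *)
Definition warped_metric (u : R -> R) (phi : R * R -> R) (x : 'rV[R]_3) :
    'M[R]_3 :=
  let f := phi (x 0 0, x 0 1) in
  diag_mx (vec3 (f ^- 2) (f ^- 2 * u (x 0 0) ^+ 2) (f ^+ 2)).

(* The product metric
   $dr^2 + \frac{4}{\pi^2} \sin^2(\pi r / 2) d\theta^2 + d\xi^2$ *)
Definition product_metric (x : 'rV[R]_3) : 'M[R]_3 :=
  diag_mx (vec3 1 (4 / pi ^+ 2 * sin (pi * x 0 0 / 2) ^+ 2) 1).

(* u is in C^oo([0, 2]), i.e. it is the restriction to [0, 2] of a function v
   that is smooth on the line; the derivatives of v at 0 and 2 are then the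
   one-sided derivatives of u. *)
Definition warping_profile (u : R -> R) : Prop :=
  [/\ exists v : R -> R, [/\ smooth setT v,
        forall r, 0 <= r <= 2 -> u r = v r, derive1 v 0 = 1 & derive1 v 2 = -1],
      forall r, 0 < r < 2 -> 0 < u r, u 0 = 0 & u 2 = 0].

(** * Modes of convergence *)

Definition uniform_cvg (T : choiceType) (D : set T) (f_ : nat -> T -> R)
    (f : T -> R) : Prop := {uniform D, f_ n @[n --> \oo] --> f}.

Definition coord_band2 (e : R) : set (R * R) :=
  `[e, 2 - e]%classic `*` `[0, 2 * pi]%classic.

Definition coord_band3 (e : R) : set 'rV[R]_3 :=
  [set x | coord_band2 e (x 0 0, x 0 1) /\ 0 <= x 0 2 <= 2 * pi].

Definition holder_norm (alpha : R) (D : set (R * R)) (f : R * R -> R) :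
    \bar R :=
  (ereal_sup [set `|f x|%:E | x in D] +
   ereal_sup [set (`|f z.1 - f z.2| / `|z.1 - z.2| `^ alpha)%:E |
                z in [set z : (R * R) * (R * R) |
                      [/\ D z.1, D z.2 & z.1 != z.2]]])%E.

(* L^p norm with respect to the measure of density w on D *)
Definition Lp_norm d (T : measurableType d) (mu : {measure set T -> \bar R})
    (D : set T) (w : T -> R) (p : R) (f : T -> R) : \bar R :=
  ((\int[mu]_(x in D) (`|f x| `^ p * w x)%:E) `^ p^-1)%E.

Definition sphere_Lp_norm (p : R) (f : R * R -> R) : \bar R :=
  Lp_norm leb2 polar_box2 (fun y => 2 / pi * sin (pi * y.1 / 2)) p f.

(* L^p norm, for the product metric, of a 2-tensor in polar coordinates *)
Definition tensor_Lp_norm (p : R) (T : 'rV[R]_3 -> 'M[R]_3) : \bar R :=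
  Lp_norm leb3 polar_box3 (fun y => volume_density product_metric (coord3 y)) p
    (fun y => tensor_norm product_metric T (coord3 y)).

Definition in_tensor_Lp (p : R) (T : 'rV[R]_3 -> 'M[R]_3) : Prop :=
  (forall a b, measurable_fun (polar_box3 : set (mR * mR * mR))
                                (fun y => T (coord3 y) a b)) /\
  (tensor_Lp_norm p T < +oo)%E.

Definition cvg_tensor_Lp (p : R) (T_ : nat -> 'rV[R]_3 -> 'M[R]_3)
    (T : 'rV[R]_3 -> 'M[R]_3) : Prop :=
  [/\ forall n, in_tensor_Lp p (T_ n), in_tensor_Lp p T &
      tensor_Lp_norm p (fun x => T_ n x - T x) @[n --> \oo] --> 0%E].

End Manifold.

(* Main.v *)
Require Import Defs.
From HB Require Import structures.
From mathcomp Require Import all_boot all_order all_algebra.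
From mathcomp Require Import all_classical all_reals all_analysis.
From mathcomp Require Import measurable_realfun ring lra.

Set Implicit Arguments.
Unset Strict Implicit.
Unset Printing Implicit Defensive.

Import Order.TTheory GRing.Theory Num.Theory.
Import numFieldNormedType.Exports.

Local Open Scope classical_set_scope.
Local Open Scope ring_scope.

(** Write $f$ for the warping factor and $b(r) = r(2 - r)$.  In orthogonal
coordinates the scalar curvature of the warped metric is
$-2 f^2 (u''/u + |\nabla \ln f|^2_h)$ ([scalar_curvature_warped]), so that
nonnegative scalar curvature says that $u |\partial_r \ln f|^2 \le -u''$; in
particular $u$ is concave.

The metrics cannot collapse.  At a maximum of $u$ the torus $r = r_0$ is minimal,
and its area $4 \pi^2 u(r_0)$ does not involve $f$ ([MinA_le_torus]).  Hence
$u(r_0) \ge A_0 / 4 \pi^2$, and concavity spreads this out to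
$u \ge c\,b$ with $c = A_0 / 16 \pi^2$.

The factor $f$ degenerates slowly at the poles.  By the inequality between
arithmetic and geometric means
$|\partial_r \ln f| \le \lambda u |\partial_r \ln f|^2 + 1 / (4 \lambda u)
\le - \lambda u'' + 1 / (4 \lambda c b)$
for every $\lambda > 0$.  The first term integrates to at most $2 \lambda$, since
$|u'| \le 1$, and the second one to at most a multiple of $\lambda^{-1} \ln (4 / b)$
([growth_bound]).  As $\lambda$ is arbitrary, $f$ and $f^{-1}$ are bounded by
$C_k b^{-k}$ for every $k > 0$, with a constant that depends only on $A_0$, $k$
and bounds for $\ln f$ on the equator $r = 1$ ([ln_growth]).  The latter are
controlled uniformly in $i$ by uniform convergence to a positive limit
([ln_bounded_of_uniform]).

For a given $p$, take $k = 1 / 2p$: the $p$-th power of the norm of the metrics is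
then $O(b^{-1})$ ([warped_coeff_bounded]).  The area density of the sphere is of
order $b$ ([sine_profile_bounds]), so the integrands that define the $L^p$ norms of
$g_i - g_\infty$ are bounded by a constant; they tend to $0$ pointwise, and
dominated convergence applies ([cvg_tensor_Lp_of_coeff]).  The same bounds show
that away from the poles the coefficients are Lipschitz functions of $u$ and $f$,
which gives the uniform convergence ([uniform_warped_coeff]). *)

(** * Directional derivatives and smooth functions *)

(** A directional derivative only sees the restriction of the function to a
    line; this is how derivatives pass between the various coordinate spaces. *)
Lemma is_derive_same_line (R : realType) (V V' W : normedModType R)
    (f : V -> W) (g : V' -> W) x v x' v' d :
  (forall h : R, f (h *: v + x) = g (h *: v' + x')) ->
  is_derive x v f d -> is_derive x' v' g d.
Proof.
move=> fg df.
have E : (fun h : R => h^-1 *: ((f \o shift x) (h *: v) - f x)) =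
         (fun h : R => h^-1 *: ((g \o shift x') (h *: v') - g x')).
  apply/funext => h /=; rewrite fg; congr (_ *: (_ - _)).
  by have := fg 0; rewrite !scale0r !add0r.
apply: DeriveDef; first by rewrite /derivable -E; exact: (@ex_derive _ _ _ _ _ _ _ df).
by rewrite /derive -E; exact: (@derive_val _ _ _ _ _ _ _ df).
Qed.

Lemma is_derive_eq_on (R : realType) (V W : normedModType R) (D : set V)
    (f g : V -> W) x v d :
  open D -> D x -> (forall y, D y -> f y = g y) ->
  is_derive x v f d -> is_derive x v g d.
Proof.
move=> oD Dx fg df.
have fgnear : \forall h \near 0^',
    h^-1 *: ((f \o shift x) (h *: v) - f x) =
    h^-1 *: ((g \o shift x) (h *: v) - g x).
  have : \forall h \near (0 : R), D (h *: v + x).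
    have : {for 0, continuous (fun h : R => h *: v + x)}.
      by apply: continuousD; [exact: scalel_continuous|exact: cst_continuous].
    move=> /(_ D); apply; rewrite scale0r add0r; exact: open_nbhs_nbhs.
  move=> /(@nbhs_dnbhs _ _)H.
  apply: filterS H => h Dh /=; rewrite !fg//.
have cg : (fun h => h^-1 *: ((g \o shift x) (h *: v) - g x)) @ 0^' --> d.
  apply: cvg_trans (near_eq_cvg fgnear) _.
  have := @ex_derive _ _ _ _ _ _ _ df; rewrite /derivable => /cvg_ex[l cl].
  by rewrite -(@derive_val _ _ _ _ _ _ _ df) /derive (cvg_lim _ cl).
apply: DeriveDef; first by apply/cvg_ex; exists d.
exact: cvg_lim cg.
Qed.

Lemma is_derive_affine (R : realType) (V W : normedModType R) (f : V -> W) x v a :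
  (forall h : R, f (h *: v + x) = h *: a + f x) -> is_derive x v f a.
Proof.
move=> fE.
have dE : (fun h : R => h^-1 *: ((f \o shift x) (h *: v) - f x)) @ 0^' --> a.
  apply: (@cvg_trans _ (cst a @ (0 : R)^')); last exact: cvg_cst.
  apply: near_eq_cvg; apply: filterS (nbhs_dnbhs_neq (0 : R)) => h h0 /=.
  by rewrite fE addrK scalerA mulVf// scale1r.
apply: DeriveDef; first by apply/cvg_ex; exists a.
exact: cvg_lim dE.
Qed.

Section ScalarDerivatives.
Variables (R : realType) (V : normedModType R) (x v : V).
Implicit Types f g : V -> R.

Lemma is_derive_cstr (c : R) : is_derive x v (fun _ => c) 0.
Proof. exact: is_derive_cst. Qed.

Lemma is_derive_mul f g df dg : is_derive x v f df -> is_derive x v g dg ->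
  is_derive x v (fun y => f y * g y) (df * g x + f x * dg).
Proof.
move=> hf hg; apply: (is_derive_eq (is_deriveM hf hg)).
by rewrite addrC [df * _]mulrC.
Qed.

Lemma is_derive_add f g df dg : is_derive x v f df -> is_derive x v g dg ->
  is_derive x v (fun y => f y + g y) (df + dg).
Proof. by move=> hf hg; exact: is_deriveD. Qed.

Lemma is_derive_opp f df : is_derive x v f df ->
  is_derive x v (fun y => - f y) (- df).
Proof. by move=> hf; exact: is_deriveN. Qed.

Lemma is_derive_inv f df : f x != 0 -> is_derive x v f df ->
  is_derive x v (fun y => (f y)^-1) (- df / f x ^+ 2).
Proof.
move=> fx hf; apply: DeriveDef; first exact: derivableV.
by rewrite deriveV// derive_val -[_ *: _]/(_ * _) mulrC mulrN mulNr.
Qed.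

Lemma is_derive_sqr f df : is_derive x v f df ->
  is_derive x v (fun y => f y ^+ 2) (2 * f x * df).
Proof.
move=> hf; apply: is_derive_eq (is_derive_mul hf hf) _; ring.
Qed.

Lemma is_derive_sqr_inv f df : f x != 0 -> is_derive x v f df ->
  is_derive x v (fun y => f y ^- 2) (- 2 * df / f x ^+ 3).
Proof.
move=> f0 hf; apply: is_derive_eq.
  by apply: is_derive_inv (is_derive_sqr hf); rewrite expf_neq0.
by move=> /=; field.
Qed.

End ScalarDerivatives.

Lemma is_derive_coord (R : realType) (m n : nat) i j (x v : 'M[R]_(m.+1, n.+1)) :
  is_derive x v (fun y => y i j) (v i j).
Proof. by apply: is_derive_affine => h; rewrite !mxE. Qed.

Section Smooth.
Variable R : realType.

Lemma smooth_is_derive (V W : normedModType R) (U : set V) (h : V -> W) x v :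
  smooth U h -> U x -> is_derive x v h ('D_v h x).
Proof. by move=> /(_ 1%N)[_ /(_ v)[dh _]] Ux; apply/derivableP/dh. Qed.

Lemma smooth_derive (V W : normedModType R) (U : set V) (h : V -> W) v :
  smooth U h -> smooth U ('D_v h).
Proof. by move=> sh k; have [_ /(_ v)[]] := sh k.+1. Qed.

End Smooth.

Lemma smooth_cst (R : realType) (V W : normedModType R) (U : set V) (c : W) :
  smooth U (fun=> c).
Proof.
move=> k; elim: k c => [|k IH] c; split=> //; try by move=> x _; exact: cst_continuous.
move=> v; split=> [x _|]; first exact: derivable_cst.
by rewrite [X in Ck _ _ X](_ : _ = fun=> 0)//; apply/funext => x; exact: derive_cst.
Qed.

Lemma smooth_affine (R : realType) (V W : normedModType R) (U : set V) (f : V -> W)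
    (a : V -> W) :
  continuous f -> (forall x v (h : R), f (h *: v + x) = h *: a v + f x) -> smooth U f.
Proof.
move=> cf fE k; have df x v := is_derive_affine (fE x v).
case: k => [|k]; split=> //; try by move=> x _; exact: cf.
move=> v; split=> [x _|]; first exact: (@ex_derive _ _ _ _ _ _ _ (df x v)).
rewrite [X in Ck _ _ X](_ : _ = fun=> a v); first exact: smooth_cst.
by apply/funext => x; exact: (@derive_val _ _ _ _ _ _ _ (df x v)).
Qed.

Section Coordinates3.
Variable R : realType.

Lemma sum3 (V : nmodType) (F : 'I_3 -> V) : \sum_i F i = F 0 + F 1 + F 2.
Proof.
rewrite !big_ord_recl big_ord0 addr0 addrA.
by congr (F _ + F _ + F _); exact/val_inj.
Qed.

Lemma forall_ord3 (P : 'I_3 -> Prop) : P 0 -> P 1 -> P 2 -> forall i, P i.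
Proof.
move=> P0 P1 P2 i.
have [->|[->|->]] // : i = 0 \/ i = 1 \/ i = 2.
by case: i => [] [|[|[|//]]] ? ; [left|right; left|right; right]; exact: val_inj.
Qed.

End Coordinates3.

Lemma vec3E (R : realType) (a b c : R) :
  vec3 a b c = a *: basis3 R 0 + b *: basis3 R 1 + c *: basis3 R 2.
Proof.
apply/rowP => j; rewrite !mxE eqxx /=.
by elim/forall_ord3: j; rewrite /= !(mulr0, mulr1, addr0, add0r).
Qed.

Lemma continuous_pair (T U V : topologicalType) (f : T -> U) (g : T -> V) x :
  {for x, continuous f} -> {for x, continuous g} ->
  {for x, continuous (fun y => (f y, g y))}.
Proof. by move=> cf cg; exact: (@cvg_pair _ _ _ _ (nbhs (f x)) (nbhs (g x))). Qed.

Lemma continuous_vec3 (R : realType) (T : topologicalType) (a b c : T -> R) x :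
  {for x, continuous a} -> {for x, continuous b} -> {for x, continuous c} ->
  {for x, continuous (fun y => vec3 (a y) (b y) (c y))}.
Proof.
move=> ca cb cc.
rewrite (_ : (fun y => _) = fun y => a y *: basis3 R 0 + b y *: basis3 R 1 + c y *: basis3 R 2).
  by apply: cvgD; first apply: cvgD; apply: cvgZ => //; exact: cvg_cst.
by apply/funext => y; rewrite vec3E.
Qed.

(** * Curvature of a diagonal metric *)

(** The functions [L i k] are the logarithmic derivatives of the scale factors
    $\sqrt{d_i}$, and [M i k] are their derivatives; all curvature quantities
    of a metric in orthogonal coordinates are polynomials in these, with
    coefficients that are rational in [d]. *)
Section DiagonalMetric.
Variables (R : realType) (G : 'rV[R]_3 -> 'M[R]_3) (D : set 'rV[R]_3).
Variables (d : 'I_3 -> 'rV[R]_3 -> R) (L M : 'I_3 -> 'I_3 -> 'rV[R]_3 -> R).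
Hypothesis oD : open D.
Hypothesis Gd : forall x, D x -> G x = diag_mx (\row_i d i x).
Hypothesis d_neq0 : forall i x, D x -> d i x != 0.
Hypothesis dL : forall i k x, D x ->
  is_derive x (basis3 R k) (d i) (2 * d i x * L i k x).

Lemma partialE a f x e : is_derive x (basis3 R a) f e -> partial a f x = e.
Proof. by move=> h; rewrite /partial derive_val. Qed.

Lemma partial_eq_on a f g x e : D x -> (forall y, D y -> f y = g y) ->
  is_derive x (basis3 R a) f e -> partial a g x = e.
Proof. by move=> Dx fg h; apply: partialE; exact: (is_derive_eq_on oD Dx fg h). Qed.

Lemma inverse_metric_diag x i j : D x ->
  inverse_metric G x i j = (d i x)^-1 *+ (i == j).
Proof.
move=> Dx; rewrite /inverse_metric.
have -> : invmx (G x) = diag_mx (\row_i (d i x)^-1).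
  have GA : G x *m diag_mx (\row_i (d i x)^-1) = 1%:M.
    rewrite Gd//; apply/matrixP => a b; rewrite mul_diag_mx !mxE.
    by case: eqP => [->|]; rewrite ?mulr0// !mulr1n divff// d_neq0.
  by rewrite -[LHS]mulmx1 -GA mulKmx//; exact: (mulmx1_unit GA).1.
by rewrite !mxE; case: eqP => // ->.
Qed.

Lemma partial_diag i j l x : D x ->
  partial i (fun y => G y j l) x = 2 * d j x * L j i x *+ (j == l).
Proof.
move=> Dx; apply: (@partial_eq_on _ (fun y => d j y *+ (j == l))) => //.
  by move=> y Dy; rewrite Gd// !mxE.
case: eqP => _; first exact: dL.
exact: is_derive_cstr.
Qed.

Lemma christoffel_diag k i j x : D x ->
  christoffel G k i j x =
  L k i x *+ (j == k) + L k j x *+ (i == k) - d i x / d k x * L i k x *+ (i == j).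
Proof.
move=> Dx; rewrite /christoffel (bigD1 k)//= big1 ?addr0; last first.
  by move=> l lk; rewrite inverse_metric_diag// eq_sym (negbTE lk) mul0r.
rewrite inverse_metric_diag// eqxx !partial_diag//.
have := d_neq0 k Dx.
case: (eqVneq j k) => [->|jk]; case: (eqVneq i k) => [->|ik];
  rewrite ?eqxx; try (case: (eqVneq i j) => [->|ij]);
  try (case: (eqVneq i k) => [->|ik']);
  rewrite ?mulr1n ?mulr0n => h; by field.
Qed.

Lemma christoffel_trace k l x : D x -> christoffel G k k l x = L k l x.
Proof.
move=> Dx; rewrite christoffel_diag// eqxx mulr1n; have := d_neq0 k Dx.
case: (eqVneq l k) => [->|lk] dk; rewrite ?eqxx ?(eq_sym k) ?(negbTE lk) ?mulr1n ?mulr0n.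
  by field.
by rewrite add0r subr0.
Qed.

Lemma christoffel_sym k l x : D x -> christoffel G k l k x = L k l x.
Proof.
move=> Dx; rewrite christoffel_diag// eqxx mulr1n; have := d_neq0 k Dx.
case: (eqVneq l k) => [->|lk] dk; rewrite ?mulr1n ?mulr0n.
  by field.
by rewrite addr0 subr0.
Qed.

Lemma christoffel_normal k i x : D x -> i != k ->
  christoffel G k i i x = - (d i x / d k x * L i k x).
Proof.
by move=> Dx ik; rewrite christoffel_diag// eqxx (negbTE ik) !mulr0n mulr1n !add0r.
Qed.

Lemma christoffel_distinct k i j x : D x -> i != j -> i != k -> j != k ->
  christoffel G k i j x = 0.
Proof.
move=> Dx ij ik jk.
by rewrite christoffel_diag// (negbTE ij) (negbTE ik) (negbTE jk) !mulr0n !addr0 subrr.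
Qed.

Hypothesis dM : forall i k x, D x -> is_derive x (basis3 R k) (L i k) (M i k x).

Lemma partial_christoffel_trace i k x : D x ->
  partial i (christoffel G k i k) x = M k i x.
Proof.
move=> Dx; apply: (@partial_eq_on _ (L k i)) => //; last exact: dM.
by move=> y Dy; rewrite christoffel_sym.
Qed.

Lemma partial_christoffel_diag i k x : D x ->
  partial k (christoffel G k i i) x =
  if i == k then M i i x else
    - (d i x / d k x) * (2 * (L i k x - L k k x) * L i k x + M i k x).
Proof.
move=> Dx; case: (eqVneq i k) => [->|ik].
  exact: partial_christoffel_trace.
apply: (@partial_eq_on _ (fun y => - (d i y * (d k y)^-1 * L i k y))) => //.
  by move=> y Dy; rewrite christoffel_normal.
apply: is_derive_eq.
  apply: is_derive_opp; apply: is_derive_mul (dM i k Dx).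
  by apply: is_derive_mul (dL i k Dx) (is_derive_inv (d_neq0 k Dx) (dL k k Dx)).
by have := d_neq0 k Dx => dk /=; field.
Qed.

(** The Ricci curvature in a coordinate direction is the sum of the sectional
    curvatures of the two coordinate planes through it.  The indices are kept
    abstract so that a single algebraic verification serves the three
    directions. *)
Lemma ricci_diag i j k x : D x -> i != j -> i != k -> j != k ->
  (forall F : 'I_3 -> R, \sum_a F a = F i + F j + F k) ->
  ricci G i i x =
  - (M j i x + L j i x ^+ 2 - L j i x * L i i x +
     M k i x + L k i x ^+ 2 - L k i x * L i i x)
  - d i x / d j x * (M i j x + L i j x ^+ 2 - L i j x * L j j x + L i j x * L k j x)
  - d i x / d k x * (M i k x + L i k x ^+ 2 - L i k x * L k k x + L i k x * L j k x).
Proof.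
move=> Dx ij ik jk sumE; have [di dj dk] := And3 (d_neq0 i Dx) (d_neq0 j Dx) (d_neq0 k Dx).
have [ji ki kj] : [/\ j != i, k != i & k != j] by rewrite !(eq_sym _ i) (eq_sym k).
rewrite /ricci !sumE !partial_christoffel_trace// !partial_christoffel_diag//.
rewrite (negbTE ij) (negbTE ik).
rewrite !(christoffel_trace _ _ Dx) !(christoffel_sym _ _ Dx).
rewrite (christoffel_normal Dx ij) (christoffel_normal Dx ik).
rewrite (christoffel_distinct Dx ij ik jk) (christoffel_distinct Dx ik ij kj).
by field; rewrite dj dk.
Qed.

(** Off-diagonal entries of the Ricci tensor, and hence mixed second derivatives
    of the metric, do not enter the trace. *)
Lemma scalar_curvature_diag x : D x ->
  scalar_curvature G x =
  - 2 * ((d 0 x)^-1 * (M 1 0 x + L 1 0 x ^+ 2 - L 1 0 x * L 0 0 x +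
                       M 2 0 x + L 2 0 x ^+ 2 - L 2 0 x * L 0 0 x +
                       L 1 0 x * L 2 0 x) +
         (d 1 x)^-1 * (M 0 1 x + L 0 1 x ^+ 2 - L 0 1 x * L 1 1 x +
                       M 2 1 x + L 2 1 x ^+ 2 - L 2 1 x * L 1 1 x +
                       L 0 1 x * L 2 1 x) +
         (d 2 x)^-1 * (M 0 2 x + L 0 2 x ^+ 2 - L 0 2 x * L 2 2 x +
                       M 1 2 x + L 1 2 x ^+ 2 - L 1 2 x * L 2 2 x +
                       L 0 2 x * L 1 2 x)).
Proof.
move=> Dx; rewrite /scalar_curvature.
have -> : \sum_i \sum_j inverse_metric G x i j * ricci G i j x =
          \sum_i (d i x)^-1 * ricci G i i x.
  apply: eq_bigr => i _; rewrite (bigD1 i)//= big1 ?addr0; last first.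
    by move=> j ji; rewrite inverse_metric_diag// eq_sym (negbTE ji) mul0r.
  by rewrite inverse_metric_diag// eqxx.
have [d0 d1 d2] := And3 (d_neq0 0 Dx) (d_neq0 1 Dx) (d_neq0 2 Dx).
have sumE (F : 'I_3 -> R) := sum3 F.
rewrite sum3; rewrite (ricci_diag (i := 0) (j := 1) (k := 2))//.
rewrite (ricci_diag (i := 1) (j := 0) (k := 2))//; last by move=> F; rewrite sum3 (addrC (F 0)).
rewrite (ricci_diag (i := 2) (j := 0) (k := 1))//; last by move=> F; rewrite sum3 addrC addrA.
by field; rewrite d0 d1 d2.
Qed.

(** The unit normal of the coordinate surfaces [x 0 0 = const] is [f] times the
    first basis vector, so besides [f'] the trace of its covariant derivative
    only involves the Christoffel symbols [christoffel a a 0]. *)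
Lemma mean_curvature_level (r0 : R) f f' x : D x ->
  (forall y, D y -> 0 < f y /\ (d 0 y)^-1 = f y ^+ 2) ->
  is_derive x (basis3 R 0) f f' ->
  mean_curvature G (fun y => y 0 0 - r0) x =
  f' + f x * (L 0 0 x + L 1 0 x + L 2 0 x).
Proof.
move=> Dx fd df.
have pF b y : partial b (fun y : 'rV[R]_3 => y 0 0 - r0) y = (b == 0)%:R.
  apply: partialE; apply: is_derive_eq.
    by apply: is_derive_add (is_derive_coord _ _ _ _) (is_derive_cstr _ _ _).
  by rewrite addr0 !mxE eqxx /= eq_sym.
have gradE y a : D y -> gradient G (fun y => y 0 0 - r0) y 0 a = f y ^+ 2 *+ (a == 0).
  move=> Dy; rewrite mxE (bigD1 0)//= big1 ?addr0; last first.
    by move=> b b0; rewrite pF (negbTE b0) mulr0.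
  rewrite pF mulr1 inverse_metric_diag//.
  by case: eqP => // ->; rewrite (fd _ Dy).2.
have innerE y : D y ->
    inner G y (gradient G (fun y => y 0 0 - r0) y) (gradient G (fun y => y 0 0 - r0) y) = f y ^+ 2.
  move=> Dy; rewrite /inner Gd// mul_mx_diag mxE (bigD1 0)//= big1 ?addr0; last first.
    by move=> b b0; rewrite mxE gradE// (negbTE b0) !mul0r.
  rewrite mxE [in X in _ * X]mxE !gradE// eqxx !mulr1n mxE -(fd _ Dy).2.
  by rewrite mulVf ?mul1r// d_neq0.
have normalE y a : D y -> unit_normal G (fun y => y 0 0 - r0) y 0 a = f y *+ (a == 0).
  move=> Dy; rewrite /unit_normal innerE// sqrtr_sqr gtr0_norm ?(fd _ Dy).1// mxE gradE//.
  have := (fd _ Dy).1; case: eqP => _ f0; rewrite ?mulr0n ?mulr0// !mulr1n expr2 mulKf// gt_eqF//.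
have termE a : partial a (fun y => unit_normal G (fun y => y 0 0 - r0) y 0 a) x
    + \sum_b christoffel G a a b x * unit_normal G (fun y => y 0 0 - r0) x 0 b
    = f' *+ (a == 0) + L a 0 x * f x.
  congr (_ + _).
    apply: (@partial_eq_on a (fun y => f y *+ (a == 0))) => //.
      by move=> y Dy; rewrite normalE.
    by case: eqP => [->|_] //; exact: is_derive_cstr.
  rewrite (bigD1 0)//= big1 ?addr0; last first.
    by move=> b b0; rewrite normalE// (negbTE b0) mulr0.
  by rewrite normalE// christoffel_trace.
rewrite /mean_curvature (eq_bigr _ (fun a _ => termE a)) sum3 /=; ring.
Qed.

End DiagonalMetric.

(** * Curvature of the warped metric *)

Lemma open_strip (R : realType) : open (@disk_domain R Polar).
Proof.
have -> : @disk_domain R Polar = fst @^-1` `]0, 2[%classic.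
  by apply/seteqP; split=> y; rewrite /= in_itv.
by apply: open_comp; [move=> y _; exact: cvg_fst|exact: interval_open].
Qed.

Section WarpedMetric.
Variables (R : realType) (G : 'rV[R]_3 -> 'M[R]_3) (u : R -> R) (f : R * R -> R).
Hypothesis Gwarped : forall x, chart_domain Polar x -> G x = warped_metric u f x.
Hypothesis u_smooth : smooth setT u.
Hypothesis u_gt0 : forall r : R, 0 < r < 2 -> 0 < u r.
Hypothesis f_smooth : smooth (disk_domain Polar) f.
Hypothesis f_gt0 : forall y, disk_domain Polar y -> 0 < f y.

Local Notation Dom := (@chart_domain R Polar).
Local Notation u' := ('D_1 u).
Local Notation u'' := ('D_1 ('D_1 u)).
Local Notation e0 := ((1, 0) : R * R).
Local Notation e1 := ((0, 1) : R * R).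

Let coord2 (x : 'rV[R]_3) : R * R := (x 0 0, x 0 1).

Lemma is_derive_radial (h : R -> R) x k : smooth setT h ->
  is_derive x (basis3 R k) (fun y => h (y 0 0)) ('D_1 h (x 0 0) *+ (k == 0)).
Proof.
move=> sh; have := smooth_is_derive (x := x 0 0) 1 sh I.
have kE (t : R) : (t *: basis3 R k + x) 0 0 = t * (k == 0)%:R + x 0 0.
  by rewrite !mxE eqxx /= eq_sym.
case: (eqVneq k 0) kE => [->|k0] kE dh.
  by apply: (is_derive_same_line _ dh) => t; rewrite kE [t *: 1]/(t * 1).
rewrite mulr0n; apply: (is_derive_same_line _ (is_derive_cstr (0 : R) 1 (h (x 0 0)))).
by move=> t; rewrite kE mulr0 add0r.
Qed.

Lemma is_derive_coord2 (h : R * R -> R) x k : smooth (disk_domain Polar) h -> Dom x ->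
  is_derive x (basis3 R k) (h \o coord2)
    (nth 0 [:: 'D_e0 h (coord2 x); 'D_e1 h (coord2 x); 0] k).
Proof.
move=> sh Dx.
have kE (t : R) : coord2 (t *: basis3 R k + x) =
    (t * (k == 0)%:R + x 0 0, t * (k == 1)%:R + x 0 1).
  by rewrite /coord2 !mxE !eqxx /= !(eq_sym _ k).
elim/forall_ord3: k kE => kE.
- apply: (is_derive_same_line _ (smooth_is_derive e0 sh Dx)) => t.
  by rewrite /= kE mulr0 mulr1 -[t *: e0]/(t * 1, t * 0) mulr1 mulr0.
- apply: (is_derive_same_line _ (smooth_is_derive e1 sh Dx)) => t.
  by rewrite /= kE mulr0 mulr1 -[t *: e1]/(t * 0, t * 1) mulr1 mulr0.
- apply: (is_derive_same_line _ (is_derive_cstr (0 : R) 1 (h (coord2 x)))) => t.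
  by rewrite /= kE !mulr0 !add0r.
Qed.

(* The logarithmic derivatives of f in r and theta and of u, each followed by
   its derivative in the same variable. *)
Let p (x : 'rV[R]_3) := 'D_e0 f (coord2 x) / f (coord2 x).
Let q (x : 'rV[R]_3) := 'D_e1 f (coord2 x) / f (coord2 x).
Let w (x : 'rV[R]_3) := u' (x 0 0) / u (x 0 0).
Let p' (x : 'rV[R]_3) := 'D_e0 ('D_e0 f) (coord2 x) / f (coord2 x) - p x ^+ 2.
Let q' (x : 'rV[R]_3) := 'D_e1 ('D_e1 f) (coord2 x) / f (coord2 x) - q x ^+ 2.
Let w' (x : 'rV[R]_3) := u'' (x 0 0) / u (x 0 0) - w x ^+ 2.

Let entry (s : seq (seq R)) (i k : 'I_3) : R := nth 0 (nth [::] s i) k.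

Let dg (i : 'I_3) (x : 'rV[R]_3) : R :=
  nth 0 [:: f (coord2 x) ^- 2; f (coord2 x) ^- 2 * u (x 0 0) ^+ 2; f (coord2 x) ^+ 2] i.
Let L (i k : 'I_3) x : R :=
  entry [:: [:: - p x; - q x; 0]; [:: w x - p x; - q x; 0]; [:: p x; q x; 0]] i k.
Let M (i k : 'I_3) x : R :=
  entry [:: [:: - p' x; - q' x; 0]; [:: w' x - p' x; - q' x; 0]; [:: p' x; q' x; 0]] i k.

Lemma open_polar : open Dom.
Proof.
have -> : Dom = (fun x : 'rV[R]_3 => x 0 0) @^-1` `]0, 2[%classic.
  by apply/seteqP; split=> x; rewrite /chart_domain /= in_itv.
apply: open_comp; last exact: interval_open.
by move=> x _; exact: coord_continuous.
Qed.

Lemma metric_diag x : Dom x -> G x = diag_mx (\row_i dg i x).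
Proof.
move=> Dx; rewrite Gwarped// /warped_metric; congr diag_mx.
Qed.

Let f_neq0 x : Dom x -> f (coord2 x) != 0.
Proof. by move=> /f_gt0/lt0r_neq0. Qed.

Let u_neq0 x : Dom x -> u (x 0 0) != 0.
Proof. by move=> /u_gt0/lt0r_neq0. Qed.

Lemma dg_neq0 i x : Dom x -> dg i x != 0.
Proof.
move=> Dx; have [fn un] := (f_neq0 Dx, u_neq0 Dx).
by elim/forall_ord3: i; rewrite /dg /= ?mulf_neq0 ?invr_neq0 ?expf_neq0.
Qed.

Lemma is_derive_dg i k x : Dom x ->
  is_derive x (basis3 R k) (dg i) (2 * dg i x * L i k x).
Proof.
move=> Dx; have [fn un] := (f_neq0 Dx, u_neq0 Dx).
have df := is_derive_coord2 k f_smooth Dx.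
have du := is_derive_radial x k u_smooth.
have df2 := is_derive_sqr_inv fn df.
elim/forall_ord3: i; rewrite /dg /=.
- apply: (is_derive_eq df2).
  by elim/forall_ord3: k {df du df2}; rewrite /L /entry /p /q /=; field.
- apply: (is_derive_eq (is_derive_mul df2 (is_derive_sqr du))).
  by elim/forall_ord3: k {df du df2}; rewrite /L /entry /w /p /q /=; field; rewrite ?un ?fn.
- apply: (is_derive_eq (is_derive_sqr df)).
  by elim/forall_ord3: k {df du df2}; rewrite /L /entry /p /q /=; field.
Qed.

Lemma is_derive_L i k x : Dom x -> is_derive x (basis3 R k) (L i k) (M i k x).
Proof.
move=> Dx; have [fn un] := (f_neq0 Dx, u_neq0 Dx).
have df j := is_derive_coord2 j f_smooth Dx.
have df0 j := is_derive_coord2 j (smooth_derive e0 f_smooth) Dx.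
have df1 j := is_derive_coord2 j (smooth_derive e1 f_smooth) Dx.
have du := is_derive_radial x 0 u_smooth.
have du' := is_derive_radial x 0 (smooth_derive (1 : R) u_smooth).
have dp : is_derive x (basis3 R 0) p (p' x).
  apply: (is_derive_eq (is_derive_mul (df0 0) (is_derive_inv fn (df 0)))).
  by rewrite /p' /p /=; field.
have dq : is_derive x (basis3 R 1) q (q' x).
  apply: (is_derive_eq (is_derive_mul (df1 1) (is_derive_inv fn (df 1)))).
  by rewrite /q' /q /=; field.
have dw : is_derive x (basis3 R 0) w (w' x).
  apply: (is_derive_eq (is_derive_mul du' (is_derive_inv un du))).
  by rewrite /w' /w /=; field.
elim/forall_ord3: k; elim/forall_ord3: i; rewrite /L /M /entry //=.
- exact: is_derive_opp dp.
- exact: is_derive_add dw (is_derive_opp dp).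
- exact: is_derive_opp dq.
- exact: is_derive_opp dq.
- exact: is_derive_cstr.
- exact: is_derive_cstr.
- exact: is_derive_cstr.
Qed.

Lemma scalar_curvature_warped x : Dom x ->
  scalar_curvature G x =
  - 2 * f (coord2 x) ^+ 2 *
    (u'' (x 0 0) / u (x 0 0) + p x ^+ 2 + q x ^+ 2 / u (x 0 0) ^+ 2).
Proof.
move=> Dx; have [fn un] := (f_neq0 Dx, u_neq0 Dx).
rewrite (scalar_curvature_diag open_polar metric_diag dg_neq0 is_derive_dg is_derive_L)//.
rewrite /L /M /entry /dg /= /w' /p' /q'.
move: (p x) (q x) (w x) (f _) (u _) (u'' _) ('D_e0 _ _) ('D_e1 _ _) fn un.
by move=> a b c F U d d0 d1 fn un; field; rewrite ?fn ?un.
Qed.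

(** The derivatives of [f] cancel, because the area density of the surfaces
    [r = const] does not depend on [f]. *)
Lemma mean_curvature_warped r0 x : Dom x -> mean_curvature G (fun y => y 0 0 - r0) x =
  f (coord2 x) * (u' (x 0 0) / u (x 0 0)).
Proof.
move=> Dx; have [fn un] := (f_neq0 Dx, u_neq0 Dx).
rewrite (mean_curvature_level open_polar metric_diag dg_neq0 is_derive_dg _ Dx _ (is_derive_coord2 0 f_smooth Dx)).
  by rewrite /L /entry /p /q /w /=; field; rewrite ?fn ?un.
by move=> y Dy; split; [exact: f_gt0|rewrite /dg /= invrK].
Qed.

End WarpedMetric.

(** * The minimal torus *)

Lemma sphere_point_polar (R : realType) (y : R * R) : sphere (sphere_point Polar y).
Proof.
rewrite /sphere /= !exprMn -mulrDr cos2Dsin2 mulr1.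
by rewrite addrC cos2Dsin2.
Qed.

Section Torus.
Variable R : realType.
Implicit Types (a b s t : R).

Lemma angle_exists a b : a ^+ 2 + b ^+ 2 = 1 ->
  exists2 t, 0 <= t < 2 * pi & cos t = a /\ sin t = b.
Proof.
move=> ab; have a1 : -1 <= a <= 1.
  have : a ^+ 2 <= 1 by rewrite -ab lerDl sqr_ge0.
  by rewrite expr2 => ?; apply/andP; split; nra.
have p0 := @pi_gt0 R; have [t0 tp] := (acos_ge0 a1, acos_lepi a1).
have cosE : cos (acos a) = a by apply: acosK; rewrite in_itv.
have sinE : sin (acos a) = `|b|.
  by rewrite sin_acos// -ab addrAC subrr add0r sqrtr_sqr.
have [b0|b0] := leP 0 b.
  exists (acos a); first by rewrite t0/=; lra.
  by rewrite cosE sinE ger0_norm.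
exists (2 * pi - acos a).
  have : acos a != 0.
    by apply/eqP => a0; move: sinE; rewrite a0 sin0 => /esym/eqP; rewrite normr_eq0 (lt_eqF b0).
  by move: t0; rewrite le_eqVlt eq_sym => /orP[/eqP->|]; rewrite ?eqxx// => t0 _; lra.
have -> : 2 * pi - acos a = - acos a + pi *+ 2 by rewrite -mulr_natr; ring.
rewrite cosD2pi sinD2pi cosN sinN.
by rewrite cosE sinE ltr0_norm// opprK.
Qed.

Lemma angle_inj s t : 0 <= s < 2 * pi -> 0 <= t < 2 * pi ->
  cos s = cos t -> sin s = sin t -> s = t.
Proof.
wlog st : s t / s <= t.
  move=> H hs ht c1 c2; have [st|/ltW ts] := leP s t; first exact: H.
  by apply/esym; apply: H.
move=> hs ht cE sE; apply/eqP; rewrite eq_le st leNgt; apply/negP => {}st.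
have p0 := @pi_gt0 R.
have cos1 : cos (t - s) = 1 by rewrite cosB cE sE -!expr2 cos2Dsin2.
have half : cos (t - s) = 1 - 2 * sin ((t - s) / 2) ^+ 2.
  rewrite {1}(splitr (t - s)) cosD -!expr2 (cos2sin2 ((t - s) / 2)); ring.
have : 0 < sin ((t - s) / 2) by apply: sin_gt0_pi; apply/andP; split; lra.
move=> s0; have : 0 < sin ((t - s) / 2) ^+ 2 by rewrite exprn_gt0.
by move=> ?; lra.
Qed.

(** Given by an equation, so that membership of a point of the polar chart reduces
    to the injectivity of the cosine. *)
Definition torus (r : R) : set ((R * R * R) * (R * R)) :=
  [set P | manifold P /\ P.1.2 = cos (pi * r / 2)].

Variable (r : R).
Hypothesis r02 : 0 < r < 2.

Lemma chart_point_torus (x : 'rV[R]_3) : 0 < x 0 0 < 2 ->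
  torus r (chart_point Polar x) <-> x 0 0 = r.
Proof.
move=> /andP[x0 x2]; have p0 := @pi_gt0 R; have /andP[r0 r2] := r02; split.
  move=> -[_ /= cE].
  suff : pi * x 0 0 / 2 = pi * r / 2.
    by move=> /(mulIf _)/= /(_ _)/(mulfI _); apply; rewrite ?invr_neq0 ?gt_eqF.
  by apply: (@cos_inj R) cE; rewrite in_itv /=; apply/andP; split; nra.
move=> xr; split; last by rewrite /= xr.
split => /=.
  exact: (@sphere_point_polar _ (x 0 0, x 0 1)).
exact: cos2Dsin2.
Qed.

Lemma torus_param P : torus r P <->
  exists s t, [/\ 0 <= s < 2 * pi, 0 <= t < 2 * pi & P = chart_point Polar (vec3 r s t)].
Proof.
have p0 := @pi_gt0 R; have /andP[r0 r2] := r02.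
split; last first.
  by move=> [s [t [_ _ ->]]]; apply/chart_point_torus; rewrite !mxE.
case: P => -[[a b] c] [d e] [[/= sp ci] cE].
have s0 : 0 < sin (pi * r / 2) by apply: sin_gt0_pi; apply/andP; split; nra.
have [|s hs [cs ss]] := @angle_exists (a / sin (pi * r / 2)) (b / sin (pi * r / 2)).
  have S2 : sin (pi * r / 2) ^+ 2 = a ^+ 2 + b ^+ 2.
    move: sp; rewrite /sphere /= => sp.
    by rewrite sin2cos2 -cE /= -sp addrK.
  by rewrite !expr_div_n -mulrDl S2 divff// -S2 expf_neq0// gt_eqF.
have [t ht [ct st]] := angle_exists ci.
exists s, t; split => //; rewrite /chart_point /= !mxE /= cs ss ct st cE.
by rewrite !(mulrC (sin _)) !divfK ?gt_eqF.
Qed.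

Lemma torus_compact : compact (torus r).
Proof.
pose h (s : R * R) : (R * R * R) * (R * R) := chart_point Polar (vec3 r s.1 s.2).
have -> : torus r = h @` (`[0, 2 * pi]%classic `*` `[0, 2 * pi]%classic).
  apply/seteqP; split => [P /torus_param[s [t [/andP[s0 s1] /andP[t0 t1] ->]]]|_ [[s t] _ <-]].
    by exists (s, t) => //; split; rewrite /= in_itv /= ?s0 ?t0 ltW.
  by rewrite /h; apply/chart_point_torus; rewrite !mxE.
apply: continuous_compact; last by apply: compact_setX; exact: segment_compact.
apply: continuous_subspaceT => s.
have c1 : cos (s'.1 : R) @[s' --> s] --> cos s.1.
  by apply: continuous_comp; [exact: cvg_fst|exact: continuous_cos].
have c2 : cos (s'.2 : R) @[s' --> s] --> cos s.2.
  by apply: continuous_comp; [exact: cvg_snd|exact: continuous_cos].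
have s1 : sin (s'.1 : R) @[s' --> s] --> sin s.1.
  by apply: continuous_comp; [exact: cvg_fst|exact: continuous_sin].
have s2 : sin (s'.2 : R) @[s' --> s] --> sin s.2.
  by apply: continuous_comp; [exact: cvg_snd|exact: continuous_sin].
rewrite (_ : h = fun s : R * R => ((sin (pi * r / 2) * cos s.1, sin (pi * r / 2) * sin s.1,
  cos (pi * r / 2)), (cos s.2, sin s.2))); last first.
  by apply/funext => y; rewrite /h /chart_point /= !mxE.
apply: continuous_pair; last exact: continuous_pair.
apply: continuous_pair; last exact: cvg_cst.
by apply: continuous_pair; apply: cvgM => //; exact: cvg_cst.
Qed.

End Torus.

Section MinimalTorus.
Variables (R : realType) (g : tensor_field R) (u : R -> R) (f : R * R -> R).
Hypothesis g_warped : forall x, chart_domain Polar x -> g Polar x = warped_metric u f x.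
Hypothesis u_smooth : smooth setT u.
Hypothesis u_gt0 : forall r : R, 0 < r < 2 -> 0 < u r.
Hypothesis f_smooth : smooth (disk_domain Polar) f.
Hypothesis f_gt0 : forall y, disk_domain Polar y -> 0 < f y.
Variable r : R.
Hypothesis r02 : 0 < r < 2.

Let torus_map (s : R * R) : 'rV[R]_3 := vec3 r s.1 s.2.

Lemma torus_minimal : 'D_1 u r = 0 -> closed_minimal_surface g (torus r).
Proof.
move=> u'r; split.
- exists (chart_point Polar (torus_map 0)).
  by apply/chart_point_torus; rewrite /torus_map ?mxE.
- by move=> P [].
- exact: torus_compact.
move=> P /torus_param[]// s [t [_ _ ->]].
exists Polar, (@chart_domain R Polar), (fun x => x 0 0 - r); split.
- split=> //; first exact: open_polar.
  by exists (vec3 r s t) => //; rewrite /chart_domain /= !mxE.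
- apply: (@smooth_affine _ _ _ _ _ (fun v : 'rV[R]_3 => v 0 0)).
    by move=> x; apply: continuousB; [exact: coord_continuous|exact: cst_continuous].
  by move=> x v h; rewrite !mxE addrA.
- move=> x _; exists 0.
  suff -> : partial 0 (fun x : 'rV[R]_3 => x 0 0 - r) x = 1 by exact: oner_neq0.
  by apply/partialE/is_derive_affine => h; rewrite !mxE/= [h *: 1]/(h * 1) addrA.
- move=> x Dx; rewrite chart_point_torus//; split => [->|/eqP]; first by rewrite subrr.
  by rewrite subr_eq0 => /eqP.
- move=> x Dx /eqP; rewrite subr_eq0 => /eqP xr.
  rewrite (mean_curvature_warped g_warped u_smooth u_gt0 f_smooth f_gt0)//.
  by rewrite xr u'r mul0r mulr0.
Qed.

Let square : set (measurableTypeR R * measurableTypeR R) :=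
  `[0, 2 * pi[%classic `*` `[0, 2 * pi[%classic.

Lemma torus_map_affine v s (h : R) :
  torus_map (h *: v + s) = h *: vec3 0 v.1 v.2 + torus_map s.
Proof.
apply/rowP; elim/forall_ord3; rewrite !mxE //=; by rewrite mulr0 add0r.
Qed.

Lemma area_density_torus s : area_density (g Polar) torus_map s = u r.
Proof.
have dT v : 'D_v torus_map s = vec3 0 v.1 v.2.
  by apply: (@derive_val _ _ _ _ _ _ _ (is_derive_affine (torus_map_affine v s))).
have Ds : chart_domain Polar (torus_map s) by rewrite /chart_domain /= !mxE.
have un := lt0r_neq0 (u_gt0 r02); have fn := lt0r_neq0 (f_gt0 Ds).
rewrite /area_density /inner !dT g_warped// /warped_metric !mul_mx_diag !mxE !sum3 !mxE /=.
have fn' : f (r, s.1) != 0 by move: fn; rewrite /= !mxE.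
rewrite (_ : (_ - _ : R) = u r ^+ 2); last by field.
by rewrite sqrtr_sqr gtr0_norm// u_gt0.
Qed.

Lemma torus_area : has_area g (torus r) (u r * (2 * pi) ^+ 2)%:E.
Proof.
have p0 := @pi_gt0 R.
exists 1%N, (fun=> Polar), (fun=> torus_map), (fun=> setT), (fun=> square); split.
- move=> k; split => //; first exact: openT.
  + by apply: measurableX; exact: measurable_itv.
  + apply: (@smooth_affine _ _ _ _ _ (fun v => vec3 0 v.1 v.2)).
      move=> s; apply: continuous_vec3; [exact: cvg_cst|exact: cvg_fst|exact: cvg_snd].
    by move=> x v h; exact: torus_map_affine.
  + by move=> s _; rewrite /chart_domain /= !mxE.
- move=> k l s t [s1 s2] [t1 t2]; rewrite !ord1 /chart_point /= !mxE /= => -[].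
  move: s1 s2 t1 t2; rewrite /= !in_itv /= => s1 s2 t1 t2.
  have s0 : sin (pi * r / 2) != 0.
    have /andP[r0 r2] := r02.
    by rewrite gt_eqF//; apply: sin_gt0_pi; apply/andP; split; nra.
  move=> /(mulfI s0) c1 /(mulfI s0) sn1 c2 sn2; split=> //.
  by rewrite [s]surjective_pairing [t]surjective_pairing; congr pair; exact: angle_inj.
- apply/seteqP; split => [P /torus_param[]// s [t [hs ht ->]]|P [k _ [s _ <-]]].
    by exists ord0 => //; exists (s, t) => //; split; rewrite /= in_itv.
  by apply/chart_point_torus; rewrite /torus_map ?mxE.
- rewrite big_ord1; under eq_integral do rewrite area_density_torus.
  rewrite integral_cst; last by apply: measurableX; exact: measurable_itv.
  rewrite EFinM; congr (_ * _)%E.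
  pose I : set R := `[0, 2 * pi[%classic.
  have -> : leb2 R square = (lebesgue_measure I * lebesgue_measure I)%E.
    by apply: product_measure1E; exact: measurable_itv.
  by rewrite lebesgue_measure_itv /= lte_fin mulr_gt0// sube0 -EFinM.
Qed.

Lemma MinA_le_torus : 'D_1 u r = 0 -> (MinA g <= (u r * (2 * pi) ^+ 2)%:E)%E.
Proof.
move=> u'r; apply: ereal_inf_lbound; exists (torus r); split.
  exact: torus_minimal.
exact: torus_area.
Qed.

End MinimalTorus.

(** * Concave profiles *)

Section Profile.
Variables (R : realType) (u : R -> R).
Hypothesis u_smooth : smooth setT u.
Local Notation u' := ('D_1 u).
Local Notation u'' := ('D_1 ('D_1 u)).
Hypothesis u''_le0 : forall r : R, 0 < r < 2 -> u'' r <= 0.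

Let du (r : R) : is_derive r 1 u (u' r).
Proof. exact: smooth_is_derive u_smooth I. Qed.

Let ddu (r : R) : is_derive r 1 u' (u'' r).
Proof. exact: smooth_is_derive (smooth_derive _ u_smooth) I. Qed.

Let cu : continuous u.
Proof. by move=> r; have [c _] := u_smooth 0; exact: c. Qed.

Let cu' : continuous u'.
Proof. by move=> r; have [c _] := smooth_derive (1 : R) u_smooth 0; exact: c. Qed.

Lemma derive_profile_nincr r s : 0 <= r -> r <= s -> s <= 2 -> u' s <= u' r.
Proof.
move=> r0 rs s2.
have df x : x \in `]0, 2[ -> derivable u' x 1.
  by move=> _; exact: (@ex_derive _ _ _ _ _ _ _ (ddu x)).
have df0 x : x \in `]0, 2[ -> derive1 u' x <= 0.
  by rewrite in_itv/= derive1E => x02; exact: u''_le0.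
have cdf : {within `[0, 2], continuous u'} by apply: continuous_subspaceT; exact: cu'.
apply: (ler0_derive1_le_cc df df0 cdf) => //.
  by rewrite in_itv /= (le_trans r0 rs).
by rewrite in_itv /= r0 (le_trans rs s2).
Qed.

Lemma profile_MVT r s : r <= s -> exists2 t, r <= t <= s & u s - u r = u' t * (s - r).
Proof.
move=> rs; have [|t] := @MVT_segment _ u u' r s rs (fun x _ => du x).
  by apply: continuous_subspaceT; exact: cu.
by rewrite in_itv; exists t.
Qed.

Hypotheses (u0 : u 0 = 0) (u2 : u 2 = 0).

(** By concavity the graph of [u] lies above the chords from the two endpoints to
    any of its points; the factor $s(2 - s)/4$ is a lower bound for both chords. *)
Lemma profile_concave r s : 0 < r < 2 -> 0 < s < 2 -> 0 <= u r -> 0 <= u s ->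
  u r * (s * (2 - s)) <= 4 * u s.
Proof.
move=> /andP[r0 r2] /andP[s0 s2] ur us.
have [sr|/ltW rs] := leP s r.
  have [t /andP[t0 t1] ut] := profile_MVT (ltW s0).
  have [t' /andP[t'0 t'1] ut'] := profile_MVT sr.
  have t't : u' t' <= u' t.
    by apply: derive_profile_nincr => //; [exact: le_trans t1 t'0|exact: le_trans t'1 (ltW r2)].
  have H : (u r - u s) * s <= (u s - u 0) * (r - s).
    by rewrite ut ut' subr0 [leRHS]mulrAC ler_wpM2r// ?(ltW s0)// ler_wpM2r// subr_ge0.
  have {}H : u r * s <= u s * r by rewrite u0 in H; lra.
  rewrite mulrA; apply: (le_trans (ler_wpM2r _ H)); first lra.
  rewrite -mulrA mulrC ler_wpM2r// (_ : 4 = 2 * 2 :> R); last by ring.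
  by apply: ler_pM; lra.
have [t /andP[t0 t1] ut] := profile_MVT (ltW s2).
have [t' /andP[t'0 t'1] ut'] := profile_MVT rs.
have t't : u' t <= u' t'.
  by apply: derive_profile_nincr => //; [exact: le_trans (ltW r0) t'0|exact: le_trans t'1 t0].
have H : (u 2 - u s) * (s - r) <= (u s - u r) * (2 - s).
  rewrite ut ut' [leRHS]mulrAC ler_wpM2r ?subr_ge0//.
  by rewrite ler_wpM2r// subr_ge0// ltW.
have {}H : u r * (2 - s) <= u s * (2 - r) by rewrite u2 in H; lra.
rewrite (mulrC s) mulrA; apply: (le_trans (ler_wpM2r _ H)); first lra.
rewrite -mulrA mulrC ler_wpM2r// (_ : 4 = 2 * 2 :> R); last by ring.
by apply: ler_pM; lra.
Qed.

Lemma profile_critical : (forall r : R, 0 < r < 2 -> 0 < u r) ->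
  exists2 r, 0 < r < 2 & u' r = 0.
Proof.
move=> u_gt0.
have [|r] := @EVT_max _ u 0 2 (ler0n _ _); first by apply: continuous_subspaceT; exact: cu.
rewrite in_itv /= => /andP[r0 r2] rmax.
have u1 : 0 < u 1 by apply: u_gt0; apply/andP; split; lra.
have ur : u 1 <= u r by apply: rmax; rewrite in_itv /=; apply/andP; split; lra.
have r02 : 0 < r < 2.
  apply/andP; split; rewrite lt_neqAle; apply/andP; split=> //; apply/eqP.
    by move=> r0'; move: ur; rewrite -r0' u0 leNgt u1.
  by move=> r2'; move: ur; rewrite r2' u2 leNgt u1.
exists r => //; apply: (@derive_val _ _ _ _ _ _ _).
apply: (@derive1_at_max _ u 0 2); rewrite ?in_itv//=.
- by move=> t _; exact: ex_derive.
- by move=> t; rewrite in_itv /= => /andP[t0 t2]; apply: rmax; rewrite in_itv /= !ltW.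
Qed.

Hypotheses (u'0 : u' 0 = 1) (u'2 : u' 2 = -1).

Lemma derive_profile_bound r : 0 <= r <= 2 -> -1 <= u' r <= 1.
Proof.
move=> /andP[r0 r2].
have := derive_profile_nincr r0 r2 (lexx _); have := derive_profile_nincr (lexx _) r0 r2.
by rewrite u'0 u'2 => -> ->.
Qed.

(** Since [r] and $2 - r$ are bounds for [u], so is their minimum, which is at most
    their product as their maximum is at least [1]. *)
Lemma profile_le r : 0 <= r <= 2 -> u r <= r * (2 - r).
Proof.
move=> /andP[r0 r2].
have [t /andP[t0 t1]] := profile_MVT r0.
have [t' /andP[t'0 t'1]] := profile_MVT r2.
have := derive_profile_bound (r := t); have := derive_profile_bound (r := t').
rewrite t0 (le_trans r0 t'0) t'1 (le_trans t1 r2) => /(_ isT)/andP[a _] /(_ isT)/andP[_ b].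
rewrite u0 u2; move: (u' t) (u' t') a b => x y a b *.
have [r1|r1] := leP r 1; nra.
Qed.

Section Growth.
Variables (psi psi' : R -> R) (c k lam : R).
Hypotheses (c_gt0 : 0 < c) (k_gt0 : 0 < k) (lamE : lam = (8 * c * k)^-1).
Hypothesis u_ge : forall r : R, 0 < r < 2 -> c * (r * (2 - r)) <= u r.
Hypothesis dpsi : forall r : R, 0 < r < 2 -> is_derive r 1 psi (psi' r).
Hypothesis psi'_le : forall r : R, 0 < r < 2 -> u r * psi' r ^+ 2 <= - u'' r.

(** The derivative of this combination is nonpositive, since
    $a \le \lambda U a^2 + 1 / (4 \lambda U)$ for $a = \psi'$ and $U = u$; with this
    [lam], the last term is absorbed by the derivative $2k / (r(2 - r))$ of the
    logarithmic one. *)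
Lemma growth_nincr (r s : R) : 0 < r -> r <= s -> s < 2 ->
  psi s + lam * u' s - k * (ln s - ln (2 - s)) <=
  psi r + lam * u' r - k * (ln r - ln (2 - r)).
Proof.
move=> r0 rs s2.
pose H x := psi x + lam * u' x - k * (ln x - ln (2 - x)).
have dH (x : R) : 0 < x < 2 -> is_derive x 1 H (psi' x + lam * u'' x - 2 * k / (x * (2 - x))).
  move=> x02; have /andP[x0 x2] := x02.
  have d1 := is_derive1_ln x0.
  have x2' : 0 < 2 - x by lra.
  have d2 : is_derive x 1 (fun y : R => ln (2 - y)) (- (2 - x)^-1).
    have d2y : is_derive x 1 (fun y : R => 2 - y) (0 - 1).
      exact: (is_derive_add (is_derive_cstr _ _ _) (is_derive_opp (is_derive_id _ _))).
    have dln : is_derive ((fun y : R => 2 - y) x) 1 (@ln R) (2 - x)^-1.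
      exact: is_derive1_ln.
    apply: (is_derive_eq (@is_derive1_comp _ (@ln R) (fun y : R => 2 - y) _ _ _ dln d2y)).
    by rewrite sub0r mulrN1.
  have dlin := is_derive_mul (is_derive_cstr x 1 lam) (ddu x).
  have dln := is_derive_mul (is_derive_cstr x 1 k) (is_derive_add d1 (is_derive_opp d2)).
  apply: (is_derive_eq (is_derive_add (is_derive_add (dpsi x02) dlin) (is_derive_opp dln))).
  by field; rewrite !gt_eqF.
have H_le (x : R) : 0 < x < 2 -> psi' x + lam * u'' x - 2 * k / (x * (2 - x)) <= 0.
  move=> x02; have := psi'_le x02; have := u_ge x02.
  have /andP[x0 x2] := x02.
  have b0 : 0 < x * (2 - x) by nra.
  move: (x * (2 - x)) (u x) (psi' x) (u'' x) b0 => b U a U2 b0 cU aU.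
  have cb : 0 < c * b by exact: mulr_gt0.
  have U0 : 0 < U by exact: lt_le_trans cb cU.
  have l0 : 0 < lam by rewrite lamE invr_gt0 !mulr_gt0.
  have Ul : (4 * lam * U)^-1 <= 2 * k / b.
    rewrite (_ : 2 * k / b = (4 * lam * (c * b))^-1).
      by rewrite lef_pV2 ?posrE ?mulr_gt0// ler_pM2l// mulr_gt0.
    by rewrite lamE; field; rewrite !gt_eqF.
  have : a <= lam * (U * a ^+ 2) + (4 * lam * U)^-1.
    rewrite -subr_ge0 (_ : _ - a = (2 * lam * U * a - 1) ^+ 2 / (4 * lam * U)).
      by rewrite divr_ge0 ?sqr_ge0// ltW// !mulr_gt0.
    by field; rewrite !gt_eqF.
  have : lam * (U * a ^+ 2) <= lam * - U2 by rewrite ler_pM2l.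
  by lra.
have dfH x : x \in `]0, 2[ -> derivable H x 1.
  by rewrite in_itv /= => /dH dHx; exact: (@ex_derive _ _ _ _ _ _ _ dHx).
have dfH0 x : x \in `]0, 2[ -> derive1 H x <= 0.
  rewrite in_itv /= => x02; rewrite derive1E (@derive_val _ _ _ _ _ _ _ (dH _ x02)).
  exact: H_le.
have cH : {in `]0, 2[%classic, continuous H}.
  by move=> x; rewrite inE => /dfH ?; exact/differentiable_continuous/derivable1_diffP.
rewrite -/(H s) -/(H r); apply: (ler0_derive1_le_oo dfH dfH0 cH) => //.
  by rewrite in_itv /= s2 andbT (lt_le_trans r0 rs).
by rewrite in_itv /= r0 (le_lt_trans rs s2).
Qed.

End Growth.

(** Monotonicity compares with the equator [r = 1] in one direction only; applied
    to [psi] and to its opposite it bounds both signs on both hemispheres. *)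
Lemma growth_bound (psi psi' : R -> R) (c k : R) : 0 < c -> 0 < k ->
  (forall r : R, 0 < r < 2 -> c * (r * (2 - r)) <= u r) ->
  (forall r : R, 0 < r < 2 -> is_derive r 1 psi (psi' r)) ->
  (forall r : R, 0 < r < 2 -> u r * psi' r ^+ 2 <= - u'' r) ->
  forall r : R, 0 < r < 2 ->
    `|psi r - psi 1| <= 2 * (8 * c * k)^-1 + k * (ln 4 - ln (r * (2 - r))).
Proof.
move=> c0 k0 uc dpsi psi_le r r02; set lam := (8 * c * k)^-1.
have /andP[r0 r2] := r02.
have lam0 : 0 < lam by rewrite invr_gt0 !mulr_gt0.
have dNpsi (s : R) : 0 < s < 2 -> is_derive s 1 (fun y => - psi y) (- psi' s).
  by move=> /dpsi ds; exact: is_derive_opp.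
have Npsi_le (s : R) : 0 < s < 2 -> u s * (- psi' s) ^+ 2 <= - u'' s.
  by rewrite sqrrN; exact: psi_le.
have lnM' (t : R) : 0 < t -> t < 2 -> 2 * ln t <= ln 4.
  move=> t0 t2; rewrite mulr_natl -lnXn// ler_ln ?posrE ?exprn_gt0//.
  by rewrite (_ : 4 = 2 ^+ 2)//; [rewrite ler_pXn2r ?nnegrE// ltW|rewrite -natrX].
rewrite lnM ?posrE ?subr_gt0//.
have := derive_profile_bound (r := r); have := derive_profile_bound (r := 1).
rewrite ler01 ler1n (ltW r0) (ltW r2) => /(_ isT)/andP[a1 a2] /(_ isT)/andP[b1 b2].
have la1 : lam * -1 <= lam * u' 1 by rewrite ler_pM2l.
have la2 : lam * u' 1 <= lam * 1 by rewrite ler_pM2l.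
have lb1 : lam * -1 <= lam * u' r by rewrite ler_pM2l.
have lb2 : lam * u' r <= lam * 1 by rewrite ler_pM2l.
have E21 : 2 - 1 = 1 :> R by lra.
rewrite ler_norml.
have [r1|/ltW r1] := leP r 1.
  have := growth_nincr c0 k0 (erefl lam) uc dpsi psi_le r0 r1 (ltr1n _ 2).
  have := growth_nincr c0 k0 (erefl lam) uc dNpsi Npsi_le r0 r1 (ltr1n _ 2).
  rewrite E21 !ln1.
  have : k * (2 * ln (2 - r)) <= k * ln 4 by rewrite ler_pM2l// lnM' //; lra.
  lra.
have := growth_nincr c0 k0 (erefl lam) uc dpsi psi_le ltr01 r1 r2.
have := growth_nincr c0 k0 (erefl lam) uc dNpsi Npsi_le ltr01 r1 r2.
rewrite E21 !ln1.
have : k * (2 * ln r) <= k * ln 4 by rewrite ler_pM2l// lnM' //; lra.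
lra.
Qed.

End Profile.

(** Nonnegative scalar curvature provides the differential inequality for [ln f],
    and the minimal torus the lower bound for [u] that it needs: the constant
    $16 \pi^2$ is the area factor $4 \pi^2$ times the factor [4] of
    [profile_concave]. *)
Lemma ln_growth (R : realType) (g : tensor_field R) (u : R -> R) (f : R * R -> R) (A0 : R) :
  (forall x, chart_domain Polar x -> g Polar x = warped_metric u f x) ->
  smooth setT u -> (forall r : R, 0 < r < 2 -> 0 < u r) -> u 0 = 0 -> u 2 = 0 ->
  'D_1 u 0 = 1 -> 'D_1 u 2 = -1 ->
  smooth (disk_domain Polar) f -> (forall y, disk_domain Polar y -> 0 < f y) ->
  nonneg_scalar_curvature g -> 0 < A0 -> (A0%:E <= MinA g)%E ->
  [/\ forall r : R, 0 <= r <= 2 -> u r <= r * (2 - r) &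
    forall k, 0 < k -> forall r t, 0 < r < 2 ->
      `|ln (f (r, t)) - ln (f (1, t))| <=
        2 * (8 * (A0 / (16 * pi ^+ 2)) * k)^-1 + k * (ln 4 - ln (r * (2 - r)))].
Proof.
move=> gw su u_gt0 u0 u2 u'0 u'2 sf f_gt0 scal A0_gt0 minA.
have curv (r t : R) : 0 < r < 2 ->
    u r * ('D_((1, 0) : R * R) f (r, t) / f (r, t)) ^+ 2 <= - 'D_1 ('D_1 u) r.
  move=> r02; have Dx : chart_domain Polar (vec3 r t 0) by rewrite /chart_domain /= !mxE.
  have := scal Polar _ Dx.
  rewrite (scalar_curvature_warped gw su u_gt0 sf f_gt0)// !mxE /=.
  have := f_gt0 (r, t) r02; have ur := u_gt0 _ r02.
  move: (u r) ur (f (r, t)) ('D_1 _ r) ('D_((1, 0) : R * R) f (r, t)).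
  move: ('D_((0, 1) : R * R) f (r, t)).
  move=> q U U0 F dd p F0 h.
  have F2 : 0 < 2 * F ^+ 2 by rewrite mulr_gt0// exprn_gt0.
  have : dd / U + (p / F) ^+ 2 + (q / F) ^+ 2 / U ^+ 2 <= 0.
    by rewrite -(pmulr_rle0 _ F2) -oppr_ge0 -!mulNr.
  have q0 : 0 <= (q / F) ^+ 2 / U ^+ 2 by rewrite divr_ge0// sqr_ge0.
  move=> h'; have : dd / U + (p / F) ^+ 2 <= 0 by lra.
  rewrite -(pmulr_rle0 _ U0) mulrDr mulrCA divff ?gt_eqF// mulr1; lra.
have u''_le0 r : 0 < r < 2 -> 'D_1 ('D_1 u) r <= 0.
  move=> r02; rewrite -oppr_ge0; apply: le_trans (curv r 0 r02).
  by rewrite mulr_ge0 ?sqr_ge0// ltW// u_gt0.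
split; first exact: profile_le.
have [r0 r02 ur0] := profile_critical su u0 u2 u_gt0.
have A0_le : A0 <= u r0 * (2 * pi) ^+ 2.
  by rewrite -lee_fin; apply: le_trans minA _; exact: (MinA_le_torus gw).
have pi0 := @pi_gt0 R.
set c := A0 / (16 * pi ^+ 2).
have c0 : 0 < c by rewrite divr_gt0// mulr_gt0// exprn_gt0.
have u_ge (r : R) : 0 < r < 2 -> c * (r * (2 - r)) <= u r.
  move=> r12; have := profile_concave su u''_le0 u0 u2 r02 r12 (ltW (u_gt0 _ r02)) (ltW (u_gt0 _ r12)).
  have /andP[ra rb] := r12.
  have cu : 4 * c <= u r0.
    rewrite /c -(ler_pM2r (_ : 0 < (2 * pi) ^+ 2)) ?exprn_gt0 ?mulr_gt0//.
    apply: (le_trans _ A0_le); have fieldE (P : R) : P != 0 -> 4 * (A0 / (16 * P ^+ 2)) * (2 * P) ^+ 2 = A0.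
      by move=> P0; field.
    by rewrite fieldE// gt_eqF.
  have b0 : 0 < r * (2 - r) by rewrite mulr_gt0// subr_gt0.
  have : 4 * c * (r * (2 - r)) <= u r0 * (r * (2 - r)) by rewrite ler_pM2r.
  lra.
move=> k k0 r t r12.
apply: (@growth_bound _ u su u''_le0 u'0 u'2 (fun r => ln (f (r, t)))
  (fun r => 'D_((1, 0) : R * R) f (r, t) / f (r, t)) c k) => //; last by move=> s s02; exact: curv.
move=> s s02.
have ds : is_derive s 1 (fun s => f (s, t)) ('D_((1, 0) : R * R) f (s, t)).
  apply: (is_derive_same_line _ (smooth_is_derive ((1, 0) : R * R) sf (_ : disk_domain Polar (s, t)))) => //.
  by move=> h; congr (f (_, _)); rewrite /= ?mulr0 ?scaler0 ?add0r.
have dl := is_derive1_ln (f_gt0 (s, t) s02).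
apply: (is_derive_eq (@is_derive1_comp _ (@ln R) (fun s : R => f (s, t)) _ _ _ dl ds)).
by rewrite mulrC.
Qed.

(** * Uniform convergence *)

Section UniformConvergence.
Variable R : realType.

Lemma uniform_cvgP (T : choiceType) (D : set T) (f_ : nat -> T -> R) (f : T -> R) :
  uniform_cvg D f_ f <->
  forall e, 0 < e -> \forall n \near \oo, forall x, D x -> `|f_ n x - f x| < e.
Proof.
split=> [H e e0|H P /uniform_nbhs[E [entE EP]]].
  have : nbhs (f : {uniform` D -> R}) [set h | forall x, D x -> `|h x - f x| < e].
    apply/uniform_nbhs; exists [set xy | ball xy.1 e xy.2]; split; first by exists e.
    by move=> h /= hE x Dx; rewrite distrC; exact: hE.
  by move=> /H.
have [e /= e0 eE] := entE.
have := H e e0; apply: filterS => n fn; apply: EP => y Dy; apply: eE => /=.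
by rewrite /ball /= distrC; exact: fn.
Qed.

(** The seminorm part of the Hoelder norm is nonnegative because the band contains
    two distinct points. *)
Lemma holder_norm_uniform (alpha eps : R) (f_ : nat -> R * R -> R) : 0 < eps < 1 ->
  holder_norm alpha (coord_band2 eps) (f_ n) @[n --> \oo] --> 0%E ->
  forall e, 0 < e -> \forall n \near \oo, forall y, coord_band2 eps y -> `|f_ n y| < e.
Proof.
move=> /andP[eps0 eps1] H e e0.
have e0' : (0 < e%:E)%E by rewrite lte_fin.
have : \forall n \near \oo, (holder_norm alpha (coord_band2 eps) (f_ n) < e%:E)%E.
  exact: (H _ (open_ereal_lt' e0')).
apply: filterS => n hn y Dy; rewrite -lte_fin; apply: le_lt_trans hn.
rewrite /holder_norm; apply: (le_trans (y := (`|f_ n y|%:E + 0)%E)); first by rewrite adde0.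
have p0 := @pi_gt0 R.
apply: leeD; first by apply: ereal_sup_ubound; exists y.
apply: le_ereal_sup_tmp; exists (`|f_ n (1, 0) - f_ n (1, 1)| /
  `|(1, 0) - (1, 1) : R * R| `^ alpha)%:E.
  exists ((1, 0), (1, 1)) => //=; split; last by apply/eqP => -[] /eqP; rewrite eq_sym oner_eq0.
    by split; rewrite /= in_itv /=; apply/andP; split; lra.
  have := @pi_ge2 R.
  by split; rewrite /= in_itv /=; apply/andP; split; lra.
by rewrite lee_fin divr_ge0// powR_ge0.
Qed.

End UniformConvergence.

(** The limit is continuous, hence bounded and bounded away from [0] by compactness,
    which handles all but finitely many terms of the sequence. *)
Lemma ln_bounded_of_uniform (R : realType) (h : nat -> R -> R) (l : R -> R) (a b : R) :
  a <= b -> (forall n, {within `[a, b], continuous (h n)}) ->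
  (forall n x, a <= x <= b -> 0 < h n x) -> (forall x, a <= x <= b -> 0 < l x) ->
  (forall e, 0 < e -> \forall n \near \oo, forall x, a <= x <= b -> `|h n x - l x| < e) ->
  exists m, forall n x, a <= x <= b -> `|ln (h n x)| <= m.
Proof.
move=> ab ch h_gt0 l_gt0 hl.
have bounds (k : R -> R) : {within `[a, b], continuous k} ->
    (forall x, a <= x <= b -> 0 < k x) ->
    exists r s, [/\ 0 < r, 0 < s & forall x, a <= x <= b -> r <= k x <= s].
  move=> ck k_gt0.
  have [x xab xmin] := EVT_min ab ck; have [y yab ymax] := EVT_max ab ck.
  rewrite in_itv /= in xab; rewrite in_itv /= in yab.
  exists (k x), (k y); split; [exact: k_gt0|exact: k_gt0|].
  by move=> z zab; rewrite xmin ?ymax// in_itv.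
have ln_bound r s z : 0 < r -> r <= z <= s -> `|ln z| <= `|ln r| + `|ln s|.
  move=> r0 /andP[rz zs]; have z0 := lt_le_trans r0 rz; have s0 := lt_le_trans z0 zs.
  have h1 : ln r <= ln z by rewrite ler_ln.
  have h2 : ln z <= ln s by rewrite ler_ln.
  have := ler_norm (ln s); have := ler_norm (- ln r); rewrite normrN => h3 h4.
  have := normr_ge0 (ln r); have := normr_ge0 (ln s) => h5 h6.
  by rewrite ler_norml; apply/andP; split; lra.
have cl : {within `[a, b], continuous l}.
  apply: (@uniform_limit_continuous_subspace _ _ _ (h n @[n --> \oo])).
    by exists 0%N => // n _; exact: ch.
  apply/uniform_cvgP => e e0; have := hl e e0; apply: filterS => n hn x.
  by rewrite /= in_itv; exact: hn.
have [r [s [r0 s0 lrs]]] := bounds l cl l_gt0.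
have [N _ hN] := hl (r / 2) (divr_gt0 r0 (ltr0n _ 2)).
have hb n : exists m, 0 <= m /\ forall x, a <= x <= b -> `|ln (h n x)| <= m.
  have [p [q [p0 q0 hpq]]] := bounds _ (ch n) (h_gt0 n).
  exists (`|ln p| + `|ln q|); split; first by rewrite addr_ge0.
  by move=> x /hpq; exact: ln_bound.
pose m_ n := projT1 (cid (hb n)).
have m_ge0 n : 0 <= m_ n by rewrite /m_; case: cid => m [].
have m_le n x : a <= x <= b -> `|ln (h n x)| <= m_ n.
  by move=> xab; rewrite /m_; case: cid => m [m0 hm]; exact: hm.
exists (\sum_(i < N) m_ i + (`|ln (r / 2)| + `|ln (s + r / 2)|)) => n x xab.
have [nN|Nn] := ltnP n N.
  apply: (le_trans (m_le n x xab)); rewrite (bigD1 (Ordinal nN))//= -addrA lerDl.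
  by rewrite !addr_ge0// sumr_ge0.
apply: (@le_trans _ _ (`|ln (r / 2)| + `|ln (s + r / 2)|)); last by rewrite lerDr sumr_ge0.
apply: ln_bound; first by rewrite divr_gt0.
have := hN n Nn x xab; rewrite ltr_norml => /andP[h1 h2].
by have /andP[h3 h4] := lrs x xab; apply/andP; split; lra.
Qed.

(** * The product metric *)

Section SineProfile.
Variable R : realType.

Lemma is_derive_sin_cos (c d a x v : R) :
  is_derive x v (fun x : R => c * sin (a * x) + d * cos (a * x))
    ((- (a * v * d)) * sin (a * x) + (a * v * c) * cos (a * x)).
Proof.
  pose l (t : R) := a * (t * v + x).
  have dl : is_derive (0 : R) 1 l (a * v).
    apply: is_derive_affine => h; rewrite /l.
    by change (a * ((h * 1 + 0) * v + x) = h * (a * v) + a * (0 * v + x)); ring.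
  have ds := @is_derive1_comp _ (@sin R) l _ _ _ (is_derive_sin (l 0)) dl.
  have dc := @is_derive1_comp _ (@cos R) l _ _ _ (is_derive_cos (l 0)) dl.
  have dT := is_derive_add (is_derive_mul (is_derive_cstr (0 : R) (1 : R) c) ds)
                          (is_derive_mul (is_derive_cstr (0 : R) (1 : R) d) dc).
  apply: (is_derive_same_line _ (is_derive_eq dT _)).
    move=> h; rewrite /= /l (_ : h *: (1 : R) + 0 = h)//.
    by rewrite addr0 [LHS]mulr1.
by rewrite /l !mul0r !add0r; ring.
Qed.

Lemma smooth_sin_cos (c d a : R) :
  smooth setT (fun x : R => c * sin (a * x) + d * cos (a * x)).
Proof.
move=> k; elim: k c d => [|k IH] c d; split=> //.
- move=> x _; apply/differentiable_continuous/derivable1_diffP.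
  exact: (@ex_derive _ _ _ _ _ _ _ (is_derive_sin_cos c d a x 1)).
- move=> x _; apply/differentiable_continuous/derivable1_diffP.
  exact: (@ex_derive _ _ _ _ _ _ _ (is_derive_sin_cos c d a x 1)).
- move=> v; split; first by move=> x _; exact: (@ex_derive _ _ _ _ _ _ _ (is_derive_sin_cos c d a x v)).
  rewrite [X in Ck _ _ X](_ : _ = fun x => (- (a * v * d)) * sin (a * x) + (a * v * c) * cos (a * x)).
    exact: IH.
  by apply/funext => x; exact: (@derive_val _ _ _ _ _ _ _ (is_derive_sin_cos c d a x v)).
Qed.

Definition sine_profile (r : R) : R := 2 / pi * sin (pi * r / 2).

(** The round sphere is itself a concave profile, so the general bounds apply to
    it. *)
Lemma sine_profile_bounds (r : R) : 0 <= r <= 2 ->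
  r * (2 - r) / (2 * pi) <= sine_profile r <= r * (2 - r).
Proof.
move=> /andP[r0 r2]; have pi0 := @pi_gt0 R.
pose a : R := pi / 2; pose W (x : R) : R := 2 / pi * sin (a * x) + 0 * cos (a * x).
have WE x : sine_profile x = W x.
  by rewrite /W mul0r addr0 /sine_profile /a; congr (_ * sin _); exact: mulrAC.
have a0 : 0 < a by rewrite divr_gt0.
have ac : a * 1 * (2 / pi) = 1.
  by rewrite mulr1 /a mulrA divfK// divff// gt_eqF.
have W'x x : 'D_1 W x = 0 * sin (a * x) + 1 * cos (a * x).
  rewrite (@derive_val _ _ _ _ _ _ _ (is_derive_sin_cos _ _ _ _ _)).
  by rewrite ac mulr0 oppr0.
have W' : 'D_1 W = fun x => 0 * sin (a * x) + 1 * cos (a * x) by exact/funext.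
have W'' x : 'D_1 ('D_1 W) x = - a * sin (a * x).
  rewrite W' (@derive_val _ _ _ _ _ _ _ (is_derive_sin_cos _ _ _ _ _)).
  by rewrite mulr0 mul0r addr0 !mulr1.
have a2 : a * 2 = pi by rewrite /a divfK.
have sin_gt0 (x : R) : 0 < x < 2 -> 0 < sin (a * x).
  move=> /andP[x0 x2]; apply: sin_gt0_pi; rewrite mulr_gt0//=.
  by rewrite -a2 ltr_pM2l.
have W''_le0 (x : R) : 0 < x < 2 -> 'D_1 ('D_1 W) x <= 0.
  by move=> /sin_gt0 ?; rewrite W'' mulNr oppr_le0 mulr_ge0// ltW.
have W_smooth : smooth setT W by exact: smooth_sin_cos.
have W0 : W 0 = 0 by rewrite /W mulr0 sin0 !(mulr0, mul0r, addr0).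
have W2 : W 2 = 0 by rewrite /W a2 sinpi !(mulr0, mul0r, addr0).
have W_gt0 (x : R) : 0 < x < 2 -> 0 < W x.
  by move=> /sin_gt0 ?; rewrite /W mul0r addr0 mulr_gt0// divr_gt0.
rewrite WE; apply/andP; split; last first.
  apply: (profile_le W_smooth W''_le0 W0 W2); rewrite ?r0 ?r2// W'x.
    by rewrite mulr0 sin0 cos0 mul0r add0r mulr1.
  by rewrite a2 sinpi cospi mulr0 add0r mul1r.
have [->|rn0] := eqVneq r 0; first by rewrite W0 !mul0r.
have [->|rn2] := eqVneq r 2; first by rewrite W2 subrr mulr0 mul0r.
have r02 : 0 < r < 2 by rewrite !lt_neqAle eq_sym rn0 rn2 r0.
have i1 : is_true ((0 : R) < (1 : R) < (2 : R)) by apply: (introT andP); split; lra.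
have := profile_concave W_smooth W''_le0 W0 W2 i1 r02 (ltW (W_gt0 _ i1)) (ltW (W_gt0 _ r02)).
rewrite {1}/W mul0r addr0 mulr1 sin_pihalf mulr1 => h.
rewrite ler_pdivrMr ?mulr_gt0// -(ler_pM2l (_ : 0 < 2 / pi)) ?divr_gt0//.
have fieldE (P w : R) : P != 0 -> 2 / P * (w * (2 * P)) = 4 * w.
  by move=> P0; field.
by rewrite fieldE ?gt_eqF.
Qed.

End SineProfile.

Section ProductMetric.
Variable R : realType.
Implicit Types (x : 'rV[R]_3).

Lemma sine_profile_gt0 (r : R) : 0 < r < 2 -> 0 < sine_profile r.
Proof.
move=> /andP[r0 r2]; have /andP[h _] : r * (2 - r) / (2 * pi) <= sine_profile r <= r * (2 - r).
  by apply: sine_profile_bounds; rewrite !ltW.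
apply: lt_le_trans h; have pi0 := @pi_gt0 R.
by rewrite divr_gt0 ?mulr_gt0// subr_gt0.
Qed.

Let dg (i : 'I_3) x : R := [:: 1; sine_profile (x 0 0) ^+ 2; 1]`_i.

Let product_diag x : chart_domain Polar x -> product_metric x = diag_mx (\row_i dg i x).
Proof.
move=> _; congr diag_mx; apply/rowP; elim/forall_ord3; rewrite !mxE //=.
by rewrite /dg /= /sine_profile exprMn expr_div_n -natrX.
Qed.

Let dg_neq0 i x : chart_domain Polar x -> dg i x != 0.
Proof.
move=> /sine_profile_gt0 s0.
by elim/forall_ord3: i; rewrite /dg /= ?oner_eq0// expf_neq0// gt_eqF.
Qed.

Lemma volume_density_product x : chart_domain Polar x ->
  volume_density (@product_metric R) x = sine_profile (x 0 0).
Proof.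
move=> Dx; rewrite /volume_density product_diag// det_diag.
rewrite !big_ord_recl big_ord0 !mxE /dg /= !mulr1 mul1r.
by rewrite sqrtr_sqr gtr0_norm// sine_profile_gt0.
Qed.

Definition diag_norm (a : 'I_3 -> R * R -> R) (y : R * R) : R :=
  Num.sqrt (a 0 y ^+ 2 + (a 1 y / sine_profile y.1 ^+ 2) ^+ 2 + a 2 y ^+ 2).

Lemma tensor_norm_diag_mx (T : 'rV[R]_3 -> 'M[R]_3) a x : chart_domain Polar x ->
  T x = diag_mx (\row_i a i (x 0 0, x 0 1)) ->
  tensor_norm (@product_metric R) T x = diag_norm a (x 0 0, x 0 1).
Proof.
move=> Dx Tx; rewrite /tensor_norm /diag_norm; congr Num.sqrt.
have gE := inverse_metric_diag product_diag dg_neq0 _ _ Dx.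
transitivity (\sum_i ((dg i x)^-1 * a i (x 0 0, x 0 1)) ^+ 2).
  apply: eq_bigr => i _.
  rewrite (bigD1 i)//= [X in _ + X]big1 ?addr0 => [|j ji]; last first.
    rewrite big1// => c _; rewrite big1// => d _.
    by rewrite Tx !mxE eq_sym (negbTE ji) mulr0n mulr0 mul0r.
  rewrite (bigD1 i)//= [X in _ + X]big1 ?addr0 => [|j ji]; last first.
    by rewrite big1// => c _; rewrite gE eq_sym (negbTE ji) mulr0n !mul0r.
  rewrite (bigD1 i)//= [X in _ + X]big1 ?addr0 => [|j ji]; last first.
    by rewrite (gE i j) eq_sym (negbTE ji) mulr0n mulr0 !mul0r.
  by rewrite !gE eqxx !mulr1n Tx !mxE eqxx !mulr1n; ring.
by rewrite sum3 /dg /= invr1 !mul1r (mulrC _ (a 1 _)).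
Qed.

Lemma diag_norm_le (a : 'I_3 -> R * R -> R) y :
  diag_norm a y <= `|a 0 y| + `|a 1 y| / sine_profile y.1 ^+ 2 + `|a 2 y|.
Proof.
have w0 : 0 <= (sine_profile y.1 ^+ 2)^-1 by rewrite invr_ge0 sqr_ge0.
rewrite -[leRHS]ger0_norm ?addr_ge0 ?mulr_ge0// -sqrtr_sqr ler_wsqrtr//.
rewrite -(real_normK (num_real (a 0 y))) -(real_normK (num_real (a 2 y))).
rewrite -(real_normK (num_real (a 1 y / _))) normrM (ger0_norm w0).
move: w0 (normr_ge0 (a 0 y)) (normr_ge0 (a 1 y)) (normr_ge0 (a 2 y)).
move: `|a 0 y| `|a 1 y| `|a 2 y| (sine_profile y.1 ^+ 2)^-1 => A B C w w0 A0 B0 C0.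
have := mulr_ge0 B0 w0; move: (B * w) => D D0.
have h1 := mulr_ge0 A0 D0; have h2 := mulr_ge0 A0 C0; have h3 := mulr_ge0 D0 C0.
rewrite -subr_ge0.
rewrite (_ : _ - _ = 2 * (A * D) + 2 * (A * C) + 2 * (D * C)); last by ring.
by rewrite !addr_ge0// mulr_ge0.
Qed.

Lemma diag_norm_ge0 a y : 0 <= diag_norm a y.
Proof. exact: sqrtr_ge0. Qed.

End ProductMetric.

(** * Convergence in $L^p$ of diagonal tensors *)

(** An open set of the plane belongs to the product sigma-algebra because it is a
    countable union of boxes with rational corners. *)
Lemma open_measurable2 (R : realType) (O : set (R * R)) : open O ->
  measurable (O : set (measurableTypeR R * measurableTypeR R)).
Proof.
move=> oO.
pose box (a b c d : rat) : set (R * R) := `]ratr a, ratr b[%classic `*` `]ratr c, ratr d[%classic.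
pose piece a b c d := [set y | box a b c d y /\ box a b c d `<=` O].
have -> : O = \bigcup_a \bigcup_b \bigcup_c \bigcup_d piece a b c d.
  apply/seteqP; split => [y Oy|y [a _ [b _ [c _ [d _ [by_ bO]]]]]]; last exact: bO.
  have [[P Q] /= [Py Qy] PQO] : nbhs y O by exact: open_nbhs_nbhs.
  have [e /= e0 eP] := Py; have [e' /= e'0 eQ] := Qy.
  have lt1 (z w : R) : 0 < w -> z - w < z by move=> ?; rewrite ltrBlDr ltrDl.
  have lt2 (z w : R) : 0 < w -> z < z + w by move=> ?; rewrite ltrDl.
  have [a] := rat_in_itvoo (lt1 y.1 _ e0); have [b] := rat_in_itvoo (lt2 y.1 _ e0).
  have [c] := rat_in_itvoo (lt1 y.2 _ e'0); have [d] := rat_in_itvoo (lt2 y.2 _ e'0).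
  rewrite !in_itv /= => /andP[d1 d2] /andP[c1 c2] /andP[b1 b2] /andP[a1 a2].
  exists a => //; exists b => //; exists c => //; exists d => //; split.
    by split; rewrite /= in_itv /= ?a2 ?b1 ?c2 ?d1.
  move=> z [/=]; rewrite !in_itv /= => /andP[z1 z2] /andP[z3 z4]; apply: PQO; split => /=.
    by apply: eP; rewrite /ball_ /= ltr_norml; apply/andP; split; lra.
  by apply: eQ; rewrite /ball_ /= ltr_norml; apply/andP; split; lra.
apply: bigcupT_measurable_rat => a; apply: bigcupT_measurable_rat => b.
apply: bigcupT_measurable_rat => c; apply: bigcupT_measurable_rat => d.
have [bO|nbO] := pselect (box a b c d `<=` O).
  rewrite (_ : piece _ _ _ _ = box a b c d); last by apply/seteqP; split => // y [].
  by apply: measurableX; exact: measurable_itv.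
by rewrite (_ : piece _ _ _ _ = set0)//; apply/seteqP; split => // y [].
Qed.

Lemma continuous_measurable2 (R : realType) (U : set (R * R)) (f : R * R -> R) :
  open U -> (forall y, U y -> {for y, continuous f}) ->
  measurable_fun (U : set (measurableTypeR R * measurableTypeR R)) (f : _ -> measurableTypeR R).
Proof.
move=> oU cf; apply: (measurability _ (measurable_realfun.RGenOpens.measurableE R)) => _ [_ [a [b ->]] <-].
apply: open_measurable2.
rewrite openE => y [Uy fy].
apply: filterI; first exact: open_nbhs_nbhs.
apply: (cf _ Uy); exact: open_nbhs_nbhs.
Qed.

Section LpConvergence.
Variable R : realType.
Local Notation mR := (measurableTypeR R).
Local Notation box2 := (@polar_box2 R).
Local Notation box3 := (@polar_box3 R).

Let measurable_box2 : measurable (box2 : set (mR * mR)).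
Proof. by apply: measurableX; exact: measurable_itv. Qed.

Let measurable_box3 : measurable (box3 : set (mR * mR * mR)).
Proof. by apply: measurableX => //; exact: measurable_itv. Qed.

Lemma leb3_box3 : leb3 R box3 = (2 * (2 * pi) ^+ 2)%:E.
Proof.
have p0 := @pi_gt0 R.
pose I : set R := `]0, 2[%classic; pose J : set R := `[0, 2 * pi]%classic.
have -> : leb3 R box3 = (leb2 R box2 * lebesgue_measure J)%E.
  by apply: product_measure1E => //; exact: measurable_itv.
have -> : leb2 R box2 = (lebesgue_measure I * lebesgue_measure J)%E.
  by apply: product_measure1E; exact: measurable_itv.
rewrite !lebesgue_measure_itv /= !lte_fin mulr_gt0// ltr0n !sube0 -!EFinM.
by congr EFin; ring.
Qed.

Lemma cvge0_le (x_ : nat -> \bar R) : (forall n, 0 <= x_ n)%E ->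
  (forall e : R, 0 < e -> \forall n \near \oo, (x_ n <= e%:E)%E) -> x_ n @[n --> \oo] --> 0%E.
Proof.
move=> x0 xe P /= [e /= e0 eP].
have := xe (e / 2) (divr_gt0 e0 (ltr0n _ 2)); apply: filterS => n.
have := x0 n; case xE : (x_ n) => [r| |] //=; rewrite !lee_fin => r0 re.
rewrite /= xE; apply: (eP r); rewrite /ball_ /= sub0r normrN ger0_norm//.
by apply: le_lt_trans re _; rewrite ltr_pdivrMr// ltr_pMr// ltr1n.
Qed.

Lemma cvge0_poweR (x_ : nat -> \bar R) (q : R) : 0 < q -> (forall n, 0 <= x_ n)%E ->
  x_ n @[n --> \oo] --> 0%E -> (x_ n `^ q)%E @[n --> \oo] --> 0%E.
Proof.
move=> q0 x0 cx; apply: cvge0_le => [n|e e0]; first exact: poweR_ge0.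
have ee : (0 < (e `^ q^-1)%:E)%E by rewrite lte_fin powR_gt0.
have xlt : \forall n \near \oo, (x_ n < (e `^ q^-1)%:E)%E by exact: (cx _ (open_ereal_lt' ee)).
apply: filterS xlt => n /ltW xn.
have -> : e = (e `^ q^-1) `^ q by rewrite -powRrM mulVf ?powRr1 ?gt_eqF// ltW.
rewrite -poweR_EFin; apply: gt0_ler_poweR; rewrite ?(ltW q0)// in_itv /= ?x0 ?leey//.
by rewrite lee_fin powR_ge0.
Qed.

Variables (p : R) (p1 : 1 <= p).
Let p_gt0 : 0 < p. Proof. exact: lt_le_trans p1. Qed.

Let coeff (T : 'rV[R]_3 -> 'M[R]_3) (a : 'I_3 -> R * R -> R) : Prop :=
  forall y, box3 y -> T (coord3 y) = diag_mx (\row_i a i y.1).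

Let meas (a : 'I_3 -> R * R -> R) : Prop :=
  forall i, measurable_fun (box2 : set (mR * mR)) (a i : mR * mR -> mR).

(** The right-hand side is the largest growth at the poles for which the $p$-th
    power of the left-hand side, times the area density, is bounded by [K]. *)
Definition bounded_coeff (K : R) (a : 'I_3 -> R * R -> R) : Prop := forall y, box2 y ->
  `|a 0 y| + `|a 1 y| / sine_profile y.1 ^+ 2 + `|a 2 y| <= (K / sine_profile y.1) `^ p^-1.

Let integrand (a : 'I_3 -> R * R -> R) (y : R * R * R) : R :=
  `|diag_norm a y.1| `^ p * sine_profile y.1.1.

Lemma tensor_Lp_normE T a : coeff T a ->
  tensor_Lp_norm p T = ((\int[leb3 R]_(y in box3) (integrand a y)%:E) `^ p^-1)%E.
Proof.
move=> Ta; rewrite /tensor_Lp_norm /Lp_norm; congr (_ `^ _)%E.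
apply: eq_integral => y; rewrite inE => by_; rewrite /integrand.
have Dy : chart_domain Polar (coord3 y).
  by have [[] + _ _] := by_; rewrite /chart_domain /= !mxE /= in_itv.
have y0 : coord3 y 0 0 = y.1.1 by rewrite mxE.
have yE : (coord3 y 0 0, coord3 y 0 1) = y.1 by rewrite !mxE /= -surjective_pairing.
rewrite volume_density_product// y0 (@tensor_norm_diag_mx _ _ a) ?yE//.
exact: Ta.
Qed.

Lemma measurable_comp_fst (h : R * R -> R) :
  measurable_fun (box2 : set (mR * mR)) (h : mR * mR -> mR) ->
  measurable_fun (box3 : set (mR * mR * mR)) (fun y => h y.1 : mR).
Proof.
move=> mh; apply: (measurable_comp (F := box2 : set (mR * mR))) => //.
  by move=> _ [y [hy _] <-].
exact: measurable_funTS measurable_fst.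
Qed.

Lemma measurable_sine_profile : measurable_fun setT (@sine_profile R : mR -> mR).
Proof.
apply: continuous_measurable_fun => x; apply: cvgM; first exact: cvg_cst.
apply: continuous_comp; last exact: continuous_sin.
by apply: cvgM; [apply: cvgM; [exact: cvg_cst|exact: cvg_id]|exact: cvg_cst].
Qed.

Let msp : measurable_fun (box2 : set (mR * mR)) (fun y => sine_profile y.1 : mR).
Proof.
apply: (measurableT_comp measurable_sine_profile).
exact: measurable_funTS measurable_fst.
Qed.

Lemma measurable_sqr_inv (h : R * R -> R) :
  measurable_fun (box2 : set (mR * mR)) (h : mR * mR -> mR) ->
  measurable_fun (box2 : set (mR * mR)) (fun y => h y ^- 2 : mR).
Proof.
move=> mh; rewrite (_ : (fun y => _) = fun y => (h y ^+ 2) `^ (-1)).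
  apply: (measurableT_comp (@measurable_powR R (-1))).
  exact: measurable_funX.
by apply/funext => y; rewrite powR_inv1// sqr_ge0.
Qed.

Lemma measurable_integrand a : meas a ->
  measurable_fun (box3 : set (mR * mR * mR)) (fun y => (integrand a y)%:E).
Proof.
move=> ma; apply/measurable_EFinP.
apply: (@measurable_comp_fst (fun y => `|diag_norm a y| `^ p * sine_profile y.1)).
apply: measurable_funM => //.
apply: (measurableT_comp (@measurable_powR R p)).
apply: (measurableT_comp (@normr_measurable R setT)).
apply: (measurableT_comp (continuous_measurable_fun (@sqrt_continuous R))).
have mw := measurable_sqr_inv msp.
have m0 := measurable_funX 2 (ma 0); have m2 := measurable_funX 2 (ma 2).
have m1 := measurable_funX 2 (measurable_funM (ma 1) mw).
exact: measurable_funD (measurable_funD m0 m1) m2.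
Qed.

Lemma integrand_ge0 a y : box3 y -> 0 <= integrand a y.
Proof.
move=> [[] /= + _ _]; rewrite in_itv /= => /sine_profile_gt0 s0.
by rewrite mulr_ge0 ?powR_ge0// ltW.
Qed.

Lemma integrand_le K a y : 0 <= K -> bounded_coeff K a -> box3 y -> integrand a y <= K.
Proof.
move=> K0 aK [hy _]; have := hy => -[] /= + _; rewrite in_itv /= => /sine_profile_gt0 s0.
rewrite /integrand -ler_pdivlMr// ger0_norm ?diag_norm_ge0//.
have -> : K / sine_profile y.1.1 = ((K / sine_profile y.1.1) `^ p^-1) `^ p.
  by rewrite -powRrM mulVf ?gt_eqF// powRr1// divr_ge0// ltW.
apply: ge0_ler_powR; rewrite ?nnegrE ?diag_norm_ge0 ?powR_ge0// ?(ltW p_gt0)//.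
exact: le_trans (diag_norm_le _ _) (aK _ hy).
Qed.

Lemma in_tensor_Lp_bounded T a K : 0 <= K -> coeff T a -> meas a -> bounded_coeff K a ->
  in_tensor_Lp p T.
Proof.
move=> K0 Ta ma aK; split.
  move=> i j; apply: (@eq_measurable_fun _ _ _ _ _ (fun y => (a i y.1 *+ (i == j)) : mR)).
    by move=> y; rewrite inE => hy; rewrite Ta// !mxE.
  case: eqP => _; first exact: measurable_comp_fst.
  exact: measurable_cst.
rewrite (tensor_Lp_normE Ta); apply: poweR_lty.
apply: (@le_lt_trans _ _ (\int[leb3 R]_(y in box3) K%:E)%E).
  apply: ge0_le_integral => //.
  - by move=> y hy; rewrite lee_fin integrand_ge0.
  - exact: measurable_integrand.
  - by move=> y hy; rewrite lee_fin integrand_le.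
by rewrite integral_cst// leb3_box3 -EFinM ltry.
Qed.

(** Dominated convergence on a set of finite measure, the integrands being bounded
    by [K]. *)
Lemma tensor_Lp_cvg0 (T_ : nat -> 'rV[R]_3 -> 'M[R]_3) a_ K : 0 <= K ->
  (forall n, coeff (T_ n) (a_ n)) -> (forall n, meas (a_ n)) ->
  (forall n, bounded_coeff K (a_ n)) ->
  (forall i y, box2 y -> a_ n i y @[n --> \oo] --> (0 : R)) ->
  tensor_Lp_norm p (T_ n) @[n --> \oo] --> 0%E.
Proof.
move=> K0 Ta ma aK a0.
rewrite (_ : (fun n => _) = fun n => ((\int[leb3 R]_(y in box3) (integrand (a_ n) y)%:E) `^ p^-1)%E); last first.
  by apply/funext => n; exact: tensor_Lp_normE.
apply: cvge0_poweR; first by rewrite invr_gt0.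
  by move=> n; apply: integral_ge0 => y hy; rewrite lee_fin integrand_ge0.
have [] := @dominated_convergence _ _ _ (leb3 R) box3 measurable_box3
  (fun n y => (integrand (a_ n) y)%:E) (cst 0%E) (cst K%:E).
- by move=> n; exact: measurable_integrand.
- exact: measurable_cst.
- apply: aeW => y hy; apply: cvg_EFin; first by near=> n.
  have s0 : 0 < sine_profile y.1.1.
    by apply: sine_profile_gt0; have [[] + _ _] := hy; rewrite /= in_itv.
  pose S n := `|a_ n 0 y.1| + `|a_ n 1 y.1| / sine_profile y.1.1 ^+ 2 + `|a_ n 2 y.1|.
  have S0 n : 0 <= S n by rewrite !addr_ge0// divr_ge0// sqr_ge0.
  have an i : `|a_ n i y.1| @[n --> \oo] --> (0 : R).
    by rewrite -(normr0 R); apply: cvg_norm; apply: a0; case: hy.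
  have cS : S n @[n --> \oo] --> (0 : R).
    rewrite -[0 in X in _ --> X]addr0 -[0 in X in _ --> X + _]addr0.
    apply: cvgD => //; apply: cvgD => //.
    by rewrite -[0 in X in _ --> X](mul0r (sine_profile y.1.1 ^+ 2)^-1); apply: cvgMl.
  apply: (@squeeze_cvgr _ _ _ _ (fun=> 0) (fun n => S n * sine_profile y.1.1)).
  + have S1 : \forall n \near \oo, S n < 1 by apply: (cvgr_lt (0 : R) cS).
    apply: filterS S1 => n /ltW S1; rewrite /= integrand_ge0//= ler_wpM2r ?(ltW s0)//.
    (* Once the norm is below 1, its p-th power is below the norm itself. *)
    have NS : diag_norm (a_ n) y.1 <= S n by exact: diag_norm_le.
    apply: le_trans NS; rewrite ger0_norm ?diag_norm_ge0//.
    have [->|N0] := eqVneq (diag_norm (a_ n) y.1) 0; first by rewrite powR0 ?gt_eqF.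
    have N1 : 0 < diag_norm (a_ n) y.1 <= 1.
      by rewrite lt_neqAle eq_sym N0 diag_norm_ge0 (le_trans (diag_norm_le _ _) S1).
    by apply: le_trans (ger_powR N1 p1) _; rewrite powRr1 ?diag_norm_ge0.
  + exact: cvg_cst.
  + by rewrite -[0 in X in _ --> X](mul0r (sine_profile y.1.1)); apply: cvgMl.
- apply/integrableP; split; first exact: measurable_cst.
  by under eq_integral do rewrite /= ger0_norm//; rewrite integral_cst// leb3_box3 -EFinM ltry.
- by apply: aeW => y n hy; rewrite /= lee_fin ger0_norm ?integrand_ge0// integrand_le.
move=> _ _; rewrite integral_cst// mul0e; exact.
Unshelve. all: by end_near. Qed.

Lemma bounded_coeff_lim a_ a K :
  (forall n, bounded_coeff K (a_ n)) ->
  (forall i y, box2 y -> a_ n i y @[n --> \oo] --> (a i y : R)) -> bounded_coeff K a.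
Proof.
move=> aK aa y hy.
have an i : `|a_ n i y| @[n --> \oo] --> `|a i y| by apply: cvg_norm; exact: aa.
have cS : (`|a_ n 0 y| + `|a_ n 1 y| / sine_profile y.1 ^+ 2 + `|a_ n 2 y|) @[n --> \oo] -->
    (`|a 0 y| + `|a 1 y| / sine_profile y.1 ^+ 2 + `|a 2 y|).
  by apply: cvgD => //; apply: cvgD => //; apply: cvgMl.
by apply: (cvgr_to_le cS); near=> n; exact: aK.
Unshelve. all: by end_near. Qed.

Lemma cvg_tensor_Lp_of_coeff T_ T a_ a K : 0 <= K ->
  (forall n, coeff (T_ n) (a_ n)) -> coeff T a -> (forall n, meas (a_ n)) ->
  (forall n, bounded_coeff K (a_ n)) ->
  (forall i y, box2 y -> a_ n i y @[n --> \oo] --> (a i y : R)) ->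
  cvg_tensor_Lp p T_ T.
Proof.
move=> K0 Tna Ta ma aK aa.
have ma' : meas a.
  move=> i; apply: (@measurable_fun_cvg _ _ _ _ (fun n => a_ n i)) => //.
    by move=> n; exact: ma.
  by move=> y hy; exact: aa.
have aK' := bounded_coeff_lim aK aa.
split.
- by move=> n; exact: (in_tensor_Lp_bounded K0 (Tna n)).
- exact: (in_tensor_Lp_bounded K0 Ta).
apply: (@tensor_Lp_cvg0 _ (fun n i y => a_ n i y - a i y) (2 `^ p * K)).
- by rewrite mulr_ge0// powR_ge0.
- move=> n y hy; rewrite Tna// Ta//; apply/matrixP => i j.
  by rewrite !mxE mulrnBl.
- by move=> n i; apply: measurable_funB; [exact: ma|exact: ma'].
- move=> n y hy.
  have := aK n y hy; have := aK' y hy.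
  have s0 : 0 < sine_profile y.1.
    by apply: sine_profile_gt0; have [+ _] := hy; rewrite /= in_itv.
  have w0 : 0 <= (sine_profile y.1 ^+ 2)^-1 by rewrite invr_ge0 sqr_ge0.
  have -> : (2 `^ p * K / sine_profile y.1) `^ p^-1 = 2 * (K / sine_profile y.1) `^ p^-1.
    rewrite -mulrA powRM ?powR_ge0// ?divr_ge0 ?(ltW s0)//.
    by rewrite -powRrM divff ?gt_eqF// powRr1.
  move: (_ `^ _) => B h1 h2.
  have n0 := ler_normB (a_ n 0 y) (a 0 y); have n2 := ler_normB (a_ n 2 y) (a 2 y).
  have n1 := ler_wpM2r w0 (ler_normB (a_ n 1 y) (a 1 y)).
  rewrite mulrDl in n1; lra.
- move=> i y hy; rewrite -(subrr (a i y)); apply: cvgB; last exact: cvg_cst.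
  exact: aa.
Qed.

End LpConvergence.

(** * Coefficients of the warped metric *)

Section WarpedCoefficients.
Variable R : realType.
Local Notation mR := (measurableTypeR R).
Implicit Types (u : R -> R) (f : R * R -> R).

Definition warped_coeff u f (i : 'I_3) (y : R * R) : R :=
  [:: f y ^- 2; f y ^- 2 * u y.1 ^+ 2; f y ^+ 2]`_i.

Lemma warped_metric_coeff u f (x : 'rV[R]_3) :
  warped_metric u f x = diag_mx (\row_i warped_coeff u f i (x 0 0, x 0 1)).
Proof. by rewrite /warped_metric; congr diag_mx. Qed.

Lemma measurable_warped_coeff u f i :
  measurable_fun setT (u : mR -> mR) ->
  measurable_fun (@polar_box2 R : set (mR * mR)) (f : mR * mR -> mR) ->
  measurable_fun (@polar_box2 R : set (mR * mR)) (warped_coeff u f i : mR * mR -> mR).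
Proof.
move=> mu mf.
have mf2 := measurable_sqr_inv mf.
have mu1 : measurable_fun (@polar_box2 R : set (mR * mR)) (fun y => u y.1 ^+ 2 : mR).
  apply: measurable_funX; apply: (measurableT_comp mu).
  exact: measurable_funTS measurable_fst.
elim/forall_ord3: i; rewrite /warped_coeff /=.
- exact: mf2.
- exact: measurable_funM mf2 mu1.
- exact: measurable_funX.
Qed.

Lemma cvg_warped_coeff (u_ : nat -> R -> R) (f_ : nat -> R * R -> R) u f i y :
  u_ n y.1 @[n --> \oo] --> u y.1 -> f_ n y @[n --> \oo] --> f y -> f y != 0 ->
  warped_coeff (u_ n) (f_ n) i y @[n --> \oo] --> warped_coeff u f i y.
Proof.
move=> cu cf fn.
have cf2 : f_ n y ^+ 2 @[n --> \oo] --> f y ^+ 2 by rewrite !expr2; exact: cvgM.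
have cu2 : u_ n y.1 ^+ 2 @[n --> \oo] --> u y.1 ^+ 2 by rewrite !expr2; exact: cvgM.
have cfi : f_ n y ^- 2 @[n --> \oo] --> f y ^- 2 by apply: cvgV => //; rewrite expf_neq0.
by elim/forall_ord3: i; rewrite /warped_coeff /=; [|apply: cvgM|].
Qed.

(** In the base of the power, [2] accounts for the first and the last coefficient
    and $4 \pi^2$ bounds the quotient of $u^2$ by the square of the sine profile;
    the outer [4] comes from the term [ln 4] of the growth estimate. *)
Definition coeff_bound (p m c : R) : R :=
  4 * ((2 + 4 * pi ^+ 2) * expR (2 * (m + 2 * (8 * c * (2 * p)^-1)^-1))) `^ p.

(** The exponent $k = 1 / 2p$ makes the $p$-th powers of $f^2$ and $f^{-2}$ singular
    of first order at the poles, and $u^2$ compensates for the norm of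
    $d\theta^2$ there. *)
Lemma warped_coeff_bounded u f (p m c : R) : 1 <= p ->
  (forall r : R, 0 < r < 2 -> 0 < u r <= r * (2 - r)) ->
  (forall y, polar_box2 y -> 0 < f y) ->
  (forall t : R, 0 <= t <= 2 * pi -> `|ln (f (1, t))| <= m) ->
  (forall k, 0 < k -> forall r t, 0 < r < 2 -> `|ln (f (r, t)) - ln (f (1, t))| <=
        2 * (8 * c * k)^-1 + k * (ln 4 - ln (r * (2 - r)))) ->
  bounded_coeff p (coeff_bound p m c) (warped_coeff u f).
Proof.
move=> p1 hu f_gt0 hm hgrowth [r t] hy; have [] := hy; rewrite /= !in_itv /= => r02 t0.
have p0 : 0 < p by exact: lt_le_trans p1.
have k0 : 0 < (2 * p)^-1 by rewrite invr_gt0 mulr_gt0.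
have pi0 := @pi_gt0 R; have /andP[r0 r2] := r02.
have b0 : 0 < r * (2 - r) by rewrite mulr_gt0// subr_gt0.
have s0 := sine_profile_gt0 r02.
have /andP[s1 s2] : r * (2 - r) / (2 * pi) <= sine_profile r <= r * (2 - r).
  by apply: sine_profile_bounds; rewrite !ltW.
have /andP[u0 u1] := hu r r02.
have f0 : 0 < f (r, t) by exact: f_gt0.
set C := m + 2 * (8 * c * (2 * p)^-1)^-1.
pose X := C + (2 * p)^-1 * (ln 4 - ln (r * (2 - r))).
have lnf : `|ln (f (r, t))| <= X.
  rewrite -(subrK (ln (f (1, t))) (ln (f (r, t)))); apply: le_trans (ler_normD _ _) _.
  rewrite /X /C addrAC -addrA (addrC m); have := hm t t0; have := hgrowth _ k0 r t r02.
  lra.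
pose E := expR (2 * X).
have E0 : 0 <= E by exact: expR_ge0.
have f2 : f (r, t) ^+ 2 <= E.
  rewrite -(lnK f0) -expRM_natl ler_expR; move: lnf; rewrite ler_norml => /andP[_ h].
  lra.
have f2V : f (r, t) ^- 2 <= E.
  rewrite -(lnK f0) -expRM_natl -expRN ler_expR; move: lnf; rewrite ler_norml => /andP[h _].
  lra.
have EE : E = expR (2 * C) * (4 / (r * (2 - r))) `^ p^-1.
  rewrite /E /powR gt_eqF ?divr_gt0// -expRD ln_div ?posrE//; congr expR.
  by rewrite /X invfM; field; rewrite gt_eqF.
have uw : (u r / sine_profile r) ^+ 2 <= 4 * pi ^+ 2.
  rewrite (_ : 4 * pi ^+ 2 = (2 * pi) ^+ 2); last by rewrite exprMn -natrX.
  have us0 : 0 <= u r / sine_profile r := divr_ge0 (ltW u0) (ltW s0).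
  have tp0 : 0 <= 2 * pi :> R := mulr_ge0 (ler0n _ 2) (ltW pi0).
  rewrite ler_pXn2r ?nnegrE//.
  rewrite ler_pdivrMr//; apply: (le_trans u1).
  by rewrite (mulrC (2 * pi)) -ler_pdivrMr// mulr_gt0.
rewrite /bounded_coeff /warped_coeff /=.
have f2V0 : 0 <= f (r, t) ^- 2 by rewrite invr_ge0 sqr_ge0.
rewrite (ger0_norm f2V0) (ger0_norm (mulr_ge0 f2V0 (sqr_ge0 _))) (ger0_norm (sqr_ge0 _)).
rewrite -mulrA -expr_div_n.
have h1 : f (r, t) ^- 2 * (u r / sine_profile r) ^+ 2 <= E * (4 * pi ^+ 2).
  by apply: ler_pM => //; rewrite sqr_ge0.
apply: (@le_trans _ _ ((2 + 4 * pi ^+ 2) * E)); first lra.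
rewrite /coeff_bound -/C.
set A := (2 + _) * expR _.
have A0 : 0 <= A by rewrite mulr_ge0 ?expR_ge0// addr_ge0// mulr_ge0// sqr_ge0.
have -> : (4 * A `^ p / sine_profile r) `^ p^-1 = A * (4 / sine_profile r) `^ p^-1.
  rewrite mulrAC mulrC powRM ?powR_ge0// ?divr_ge0 ?(ltW s0)//.
  by rewrite -powRrM divff ?gt_eqF// powRr1.
rewrite EE mulrA ler_wpM2l//.
apply: ge0_ler_powR; rewrite ?nnegrE ?divr_ge0 ?invr_ge0 ?(ltW p0) ?(ltW b0) ?(ltW s0)//.
by rewrite ler_pM2l// lef_pV2 ?posrE.
Qed.

(** Where $f^2$, $f^{-2}$ and [u] are bounded, the coefficients are Lipschitz
    functions of [u] and [f]. *)
Lemma uniform_warped_coeff (D : set (R * R)) (u_ : nat -> R -> R) (f_ : nat -> R * R -> R)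
    u f (E : R) i :
  (forall n y, D y -> [/\ 0 < f_ n y, f_ n y ^+ 2 <= E & f_ n y ^- 2 <= E]) ->
  (forall y, D y -> [/\ 0 < f y, f y ^+ 2 <= E & f y ^- 2 <= E]) ->
  (forall n y, D y -> 0 <= u_ n y.1 <= 1) -> (forall y, D y -> 0 <= u y.1 <= 1) ->
  (forall e, 0 < e -> \forall n \near \oo, forall y, D y -> `|f_ n y - f y| < e) ->
  (forall e, 0 < e -> \forall n \near \oo, forall y, D y -> `|u_ n y.1 - u y.1| < e) ->
  forall e, 0 < e -> \forall n \near \oo, forall y, D y ->
    `|warped_coeff (u_ n) (f_ n) i y - warped_coeff u f i y| < e.
Proof.
move=> hf_ hf hu_ hu cf cu e e0.
have [D0|/set0P[y0 Dy0]] := eqVneq D set0.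
  by near=> n => y; rewrite D0.
have E0 : 0 < E by have [h1 h2 _] := hf y0 Dy0; apply: lt_le_trans h2; rewrite exprn_gt0.
(* A and B are Lipschitz constants of the square and of its inverse. *)
pose A := 2 * (1 + E); have A0 : 0 < A by rewrite mulr_gt0// addr_gt0.
pose B := E ^+ 2 * A; have B0 : 0 < B by rewrite mulr_gt0// exprn_gt0.
pose d := e / (A + B + 2 * E + 1).
have den0 : 0 < A + B + 2 * E + 1 by rewrite !addr_gt0// mulr_gt0.
have d0 : 0 < d by rewrite divr_gt0.
have dE : d * (A + B + 2 * E + 1) = e by rewrite divfK// gt_eqF.
apply: filterS2 (cf d d0) (cu d d0) => n cfn cun y Dy.
have hfn := cfn y Dy; have hun := cun y Dy.
have [F0 F2 F2V] := hf_ n y Dy; have [G0 G2 G2V] := hf y Dy.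
have /andP[U0 U1] := hu_ n y Dy; have /andP[V0 V1] := hu y Dy.
have sq : `|f_ n y ^+ 2 - f y ^+ 2| <= A * d.
  rewrite subr_sqr normrM mulrC; apply: ler_pM => //; last exact: ltW.
  rewrite ger0_norm ?addr_ge0 ?(ltW F0) ?(ltW G0)//.
  have t (z : R) : z <= 1 + z ^+ 2.
    have := sqr_ge0 (z - 1); have := sqr_ge0 z.
    rewrite sqrrB expr1n mulr1 mulr2n; lra.
  by have := t (f_ n y); have := t (f y); rewrite /A; lra.
have sqV : `|f_ n y ^- 2 - f y ^- 2| <= B * d.
  rewrite (_ : _ - _ = f_ n y ^- 2 * f y ^- 2 * (f y ^+ 2 - f_ n y ^+ 2)); last first.
    by field; rewrite !gt_eqF.
  rewrite normrM distrC ger0_norm; last by rewrite mulr_ge0// invr_ge0 sqr_ge0.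
  rewrite /B -mulrA; apply: ler_pM => //; first by rewrite mulr_ge0// invr_ge0 sqr_ge0.
  by rewrite expr2; apply: ler_pM => //; rewrite invr_ge0 sqr_ge0.
have su : `|u_ n y.1 ^+ 2 - u y.1 ^+ 2| <= d * 2.
  rewrite subr_sqr normrM; apply: ler_pM => //; first exact: ltW.
  by rewrite ger0_norm; lra.
have dA : 0 < d * A by rewrite mulr_gt0.
have dB : 0 < d * B by rewrite mulr_gt0.
have dE' : 0 < d * E by rewrite mulr_gt0.
have : A * d < e /\ B * d + E * (d * 2) < e.
  by rewrite -dE; split; lra.
move=> [h1 h2]; elim/forall_ord3: i; rewrite /warped_coeff /=.
- by apply: le_lt_trans sqV _; have := mulr_gt0 E0 d0; lra.
- apply: le_lt_trans h2.
  rewrite (_ : _ - _ = (f_ n y ^- 2 - f y ^- 2) * u_ n y.1 ^+ 2 +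
                       f y ^- 2 * (u_ n y.1 ^+ 2 - u y.1 ^+ 2)); last by ring.
  apply: le_trans (ler_normD _ _) _; apply: lerD.
    rewrite normrM -[leRHS]mulr1; apply: ler_pM => //.
    by rewrite ger0_norm ?sqr_ge0// expr_le1.
  rewrite normrM; apply: ler_pM => //.
  by rewrite ger0_norm// invr_ge0 sqr_ge0.
- exact: le_lt_trans sq h1.
Unshelve. all: by end_near. Qed.

End WarpedCoefficients.

(** * Convergence of the metrics *)

(** All estimates that a single metric of the sequence satisfies; they are proved
    for the smooth extension of the profile to the line, which gives the same
    metric. *)
Lemma warped_metric_estimates (R : realType) (g : tensor_field R) (u : R -> R)
    (phi : R * R * R -> R) (A0 : R) :
  warping_profile u -> smooth_on_sphere phi -> (forall q, sphere q -> 0 < phi q) ->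
  (forall x, chart_domain Polar x -> g Polar x = warped_metric u (phi \o sphere_point Polar) x) ->
  0 < A0 -> nonneg_scalar_curvature g -> (A0%:E <= MinA g)%E ->
  let f := phi \o sphere_point Polar in
  [/\ exists v : R -> R, continuous v /\ forall r, 0 <= r <= 2 -> u r = v r,
      forall r : R, 0 < r < 2 -> 0 < u r <= r * (2 - r),
      forall y, disk_domain Polar y -> {for y, continuous f} &
      forall k, 0 < k -> forall r t, 0 < r < 2 ->
        `|ln (f (r, t)) - ln (f (1, t))| <=
          2 * (8 * (A0 / (16 * pi ^+ 2)) * k)^-1 + k * (ln 4 - ln (r * (2 - r)))].
Proof.
move=> [[v [sv uv v'0 v'2]] u_gt0 u0 u2] sphi phi_gt0 gw A0_gt0 scal minA f.
have f_gt0 y : 0 < f y by apply: phi_gt0; exact: sphere_point_polar.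
have sf : smooth (disk_domain Polar) f by exact: (sphi Polar).
have itvW (r : R) : 0 < r < 2 -> 0 <= r <= 2 by move=> /andP[r0 r2]; rewrite !ltW.
have gv x : chart_domain Polar x -> g Polar x = warped_metric v f x.
  by move=> Dx; rewrite gw// /warped_metric uv// itvW.
have v_gt0 (r : R) : 0 < r < 2 -> 0 < v r.
  by move=> r02; rewrite -uv ?u_gt0// itvW.
have v0 : v 0 = 0 by rewrite -uv// lexx ler0n.
have v2 : v 2 = 0 by rewrite -uv// lexx ler0n.
rewrite derive1E in v'0; rewrite derive1E in v'2.
have [vle growth] := ln_growth gv sv v_gt0 v0 v2 v'0 v'2 sf (fun y _ => f_gt0 y) scal A0_gt0 minA.
split=> //.
- by exists v; split=> // r; have [cv _] := sv 0; exact: cv.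
- by move=> r r02; rewrite u_gt0//= uv ?vle// itvW.
- by have [] := sf 0.
Qed.

Theorem theorem1p4 (R : realType)
  (g : nat -> tensor_field R) (u : nat -> R -> R)
  (phi : nat -> R * R * R -> R) (V0 A0 : R)
  (sigma : nat -> nat) (u_lim : R -> R) (phi_lim : R * R -> R)
  (g_metric : forall i, riemannian_metric (g i))
  (u_profile : forall i, warping_profile (u i))
  (phi_smooth : forall i, smooth_on_sphere (phi i))
  (phi_pos : forall i p, sphere p -> 0 < phi i p)
  (g_warped : forall i x, chart_domain Polar x ->
     g i Polar x = warped_metric (u i) (phi i \o sphere_point Polar) x)
  (V0_pos : 0 < V0) (A0_pos : 0 < A0)
  (scal_ge0 : forall i, nonneg_scalar_curvature (g i))
  (vol_le : forall i, (volume (g i) <= V0%:E)%E)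
  (minA_ge : forall i, (A0%:E <= MinA (g i))%E)
  (sigma_incr : {homo sigma : i j / (i < j)%N})
  (u_cvg : uniform_cvg `[0, 2]%classic (fun i => u (sigma i)) u_lim)
  (phi_lim_pos : forall y, polar_box2 y -> 0 < phi_lim y)
  (phi_cvg_holder : forall alpha eps : R,
     0 < alpha < 2^-1 -> 0 < eps < 1 ->
     holder_norm alpha (coord_band2 eps)
       (fun y => phi (sigma i) (sphere_point Polar y) - phi_lim y)
       @[i --> \oo] --> 0%E)
  (phi_cvg_Lp : forall p : R, 1 <= p ->
     sphere_Lp_norm p
       (fun y => phi (sigma i) (sphere_point Polar y) - phi_lim y)
       @[i --> \oo] --> 0%E) :
  (forall p : R, 1 <= p ->
     cvg_tensor_Lp p (fun i => g (sigma i) Polar)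
       (warped_metric u_lim phi_lim)) /\
  (forall eps : R, 0 < eps < 1 -> forall a b : 'I_3,
     uniform_cvg (coord_band3 eps)
       (fun i x => g (sigma i) Polar x a b)
       (fun x => warped_metric u_lim phi_lim x a b)).
Proof.
pose f i : R * R -> R := phi (sigma i) \o sphere_point Polar.
pose c : R := A0 / (16 * pi ^+ 2).
have pi0 := @pi_gt0 R.
have est i := warped_metric_estimates (u_profile (sigma i)) (phi_smooth (sigma i))
  (phi_pos (sigma i)) (g_warped (sigma i)) A0_pos (scal_ge0 (sigma i)) (minA_ge (sigma i)).
have f_gt0 i y : 0 < f i y by apply: phi_pos; exact: sphere_point_polar.
have u_bnd i (r : R) : 0 < r < 2 -> 0 < u (sigma i) r <= r * (2 - r).
  by have [_ + _ _] := est i; exact.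
(* Any Hoelder exponent below 1/2 will do. *)
have f_unif (eps : R) : 0 < eps < 1 -> forall e, 0 < e ->
    \forall n \near \oo, forall y, coord_band2 eps y -> `|f n y - phi_lim y| < e.
  move=> eps01; apply: (@holder_norm_uniform _ 4^-1) => //.
  apply: phi_cvg_holder => //; apply/andP; split; lra.
have band_box (eps : R) (y : R * R) : 0 < eps -> coord_band2 eps y -> polar_box2 y.
  move=> eps0 []; rewrite /= !in_itv /= => /andP[y0 y2] yt; split; rewrite /= in_itv//=.
  by apply/andP; split; lra.
have box_band (y : R * R) : polar_box2 y -> exists2 eps : R, 0 < eps < 1 & coord_band2 eps y.
  move=> []; rewrite /= !in_itv /= => /andP[y0 y2] yt.
  exists (y.1 * (2 - y.1) / 2); first by apply/andP; split; nra.
  by split; rewrite /= in_itv//=; apply/andP; split; nra.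
have f_ptw (y : R * R) : polar_box2 y -> f n y @[n --> \oo] --> phi_lim y.
  move=> /box_band[eps eps01 hy]; apply/cvgrPdist_lt => e e0.
  by have := f_unif eps eps01 e e0; apply: filterS => n hn; rewrite distrC; exact: hn.
have u_unif (e : R) : 0 < e ->
    \forall n \near \oo, forall r : R, 0 <= r <= 2 -> `|u (sigma n) r - u_lim r| < e.
  move=> e0; have /uniform_cvgP/(_ e e0) := u_cvg; apply: filterS => n hn r r02.
  by apply: hn; rewrite /= in_itv.
have u_ptw (r : R) : 0 <= r <= 2 -> u (sigma n) r @[n --> \oo] --> u_lim r.
  move=> r02; apply/cvgrPdist_lt => e e0.
  by have := u_unif e e0; apply: filterS => n hn; rewrite distrC; exact: hn.
have equator (t : R) : 0 <= t <= 2 * pi -> coord_band2 (2^-1) ((1, t) : R * R).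
  by move=> ht; split; rewrite /= in_itv//=; apply/andP; split; lra.
(* Bounds on the equator, which calibrate the growth estimates. *)
have [m hm] : exists m, forall n t, 0 <= t <= 2 * pi -> `|ln (f n (1, t))| <= m.
  apply: (@ln_bounded_of_uniform _ (fun n t => f n (1, t)) (fun t => phi_lim (1, t))).
  - by rewrite mulr_ge0// ltW.
  - move=> n; apply: continuous_subspaceT => t.
    have [_ _ cf _] := est n.
    apply: (@continuous_comp _ _ _ (fun t : R => (1 : R, t)) (f n)).
      by apply: continuous_pair; [exact: cst_continuous|exact: cvg_id].
    by apply: cf; apply/andP; split => /=; lra.
  - by move=> n t _; exact: f_gt0.
  - move=> t ht; apply: phi_lim_pos; apply: band_box (equator t ht).
    by rewrite invr_gt0.
  - move=> e e0; have [] : 0 < (2^-1 : R) < 1 by apply/andP; split; lra.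
    move=> /f_unif/(_ e e0); apply: filterS => n hn t ht; apply: hn; exact: equator.
have coeff_cvg i y : polar_box2 y -> warped_coeff (u (sigma n)) (f n) i y @[n --> \oo] -->
    warped_coeff u_lim phi_lim i y.
  move=> hy; apply: cvg_warped_coeff; last by rewrite gt_eqF// phi_lim_pos.
    apply: u_ptw; have [] := hy; rewrite /= in_itv /= => /andP[y0 y2] _.
    by rewrite !ltW.
  exact: f_ptw.
have coeff_bnd (p : R) n : 1 <= p ->
    bounded_coeff p (coeff_bound p m c) (warped_coeff (u (sigma n)) (f n)).
  move=> p1; have [_ _ _ growth] := est n.
  exact: (warped_coeff_bounded p1 (u_bnd n) (fun y _ => f_gt0 n y) (hm n) growth).
have gE i x : chart_domain Polar x ->
    g (sigma i) Polar x = diag_mx (\row_j warped_coeff (u (sigma i)) (f i) j (x 0 0, x 0 1)).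
  by move=> Dx; rewrite g_warped// warped_metric_coeff.
have K0 (p : R) : 0 <= coeff_bound p m c by rewrite mulr_ge0// powR_ge0.
have coordE (y : R * R * R) : (coord3 y 0 0, coord3 y 0 1) = y.1.
  by rewrite !mxE /= -surjective_pairing.
split=> [p p1|eps eps01 a b].
  apply: (@cvg_tensor_Lp_of_coeff _ p p1 _ _ (fun n => warped_coeff (u (sigma n)) (f n))
    (warped_coeff u_lim phi_lim) _ (K0 p)) => //.
  - move=> n y hy; have Dy : chart_domain Polar (coord3 y).
      by have [[] + _ _] := hy; rewrite /chart_domain /= !mxE /= in_itv.
    by rewrite gE// coordE.
  - by move=> y hy; rewrite warped_metric_coeff coordE.
  - move=> n i; have [[v [cv uv]] _ cf _] := est n.
    have mf : measurable_fun (@polar_box2 R : set (measurableTypeR R * measurableTypeR R))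
        (f n : _ -> measurableTypeR R).
      apply: (@measurable_funS _ _ _ _ (disk_domain Polar)).
      + by apply: open_measurable2; exact: open_strip.
      + by move=> y []; rewrite /= in_itv.
      + by apply: continuous_measurable2 => //; exact: open_strip.
    apply: (@eq_measurable_fun _ _ _ _ _ (warped_coeff v (f n) i)); last first.
      by apply: measurable_warped_coeff => //; exact: continuous_measurable_fun.
    move=> y; rewrite inE => -[]; rewrite /= in_itv /= => /andP[y0 y2] _.
    by rewrite /warped_coeff uv// !ltW.
  - by move=> n; exact: coeff_bnd.
have eps0 : 0 < eps by have /andP[] := eps01.
(* On the band the area density is at least eps / (2 * pi), so the bounds for
   p = 1 become uniform there. *)
pose E : R := coeff_bound 1 m c * (2 * pi) / eps.
have band_bound (v : R -> R) (h : R * R -> R) y : coord_band2 eps y ->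
    bounded_coeff 1 (coeff_bound 1 m c) (warped_coeff v h) ->
    h y ^+ 2 <= E /\ h y ^- 2 <= E.
  move=> hy hK; have := hK y (band_box _ _ eps0 hy).
  have [] := hy; rewrite /= !in_itv /= => /andP[y1 y2] _.
  have /andP[s1 _] : y.1 * (2 - y.1) / (2 * pi) <= sine_profile y.1 <= y.1 * (2 - y.1).
    by apply: sine_profile_bounds; apply/andP; split; lra.
  have b1 : eps <= y.1 * (2 - y.1) by have /andP[] := eps01; nra.
  have s2 : eps / (2 * pi) <= sine_profile y.1.
    by apply: le_trans s1; rewrite ler_pM2r// invr_gt0 mulr_gt0.
  have e0 : 0 < eps / (2 * pi) by rewrite divr_gt0// mulr_gt0.
  have s0 := lt_le_trans e0 s2.
  rewrite invr1 powRr1 ?divr_ge0 ?(ltW s0)// => hE.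
  have KE : coeff_bound 1 m c / sine_profile y.1 <= E.
    rewrite /E -mulrA ler_wpM2l// -[leRHS]invf_div.
    by rewrite lef_pV2 ?posrE.
  have w0 : 0 <= (sine_profile y.1 ^+ 2)^-1 by rewrite invr_ge0 sqr_ge0.
  have a1 := mulr_ge0 (normr_ge0 (warped_coeff v h 1 y)) w0.
  have a0 := ler_norm (warped_coeff v h 0 y); have a2 := ler_norm (warped_coeff v h 2 y).
  have a0' := normr_ge0 (warped_coeff v h 0 y); have a2' := normr_ge0 (warped_coeff v h 2 y).
  have -> : h y ^+ 2 = warped_coeff v h 2 y by [].
  have -> : h y ^- 2 = warped_coeff v h 0 y by [].
  by split; lra.
have coeff_lim_bnd : bounded_coeff 1 (coeff_bound 1 m c) (warped_coeff u_lim phi_lim).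
  by apply: (@bounded_coeff_lim _ 1 (fun n => warped_coeff (u (sigma n)) (f n))) => // n; exact: coeff_bnd.
have u01 n (r : R) : 0 < r < 2 -> 0 <= u (sigma n) r <= 1.
  move=> r02; have /andP[h1 h2] := u_bnd n r r02; rewrite ltW//=; apply: le_trans h2 _.
  have := sqr_ge0 (r - 1); rewrite sqrrB expr1n mulr1 mulr2n; lra.
have band_r y : coord_band2 eps y -> 0 < y.1 < 2.
  by move=> /(band_box _ _ eps0)[]; rewrite /= in_itv.
apply/uniform_cvgP => e e0.
have H : \forall n \near \oo, forall y, coord_band2 eps y ->
    `|warped_coeff (u (sigma n)) (f n) a y - warped_coeff u_lim phi_lim a y| < e.
  apply: (@uniform_warped_coeff _ _ _ _ _ _ E a) => //.
  - by move=> n y hy; have [h1 h2] := band_bound _ _ _ hy (coeff_bnd 1 n (lexx _)).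
  - move=> y hy; have [h1 h2] := band_bound _ _ _ hy coeff_lim_bnd.
    by split=> //; apply: phi_lim_pos; exact: band_box hy.
  - by move=> n y /band_r; exact: u01.
  - move=> y /band_r y02; have cu : u (sigma n) y.1 @[n --> \oo] --> u_lim y.1.
      by apply: u_ptw; have /andP[y0 y2] := y02; rewrite !ltW.
    apply/andP; split.
      by apply: (cvgr_to_ge cu); near=> n; have /andP[] := u01 n _ y02.
    by apply: (cvgr_to_le cu); near=> n; have /andP[] := u01 n _ y02.
  - exact: f_unif.
  - move=> d d0; have := u_unif d d0; apply: filterS => n hn y /band_r /andP[y0 y2].
    by apply: hn; rewrite !ltW.
apply: filterS H => n hn x [hx _].
have Dx : chart_domain Polar x by exact: (band_r _ hx).
rewrite gE// warped_metric_coeff !mxE; case: eqP => [_|_]; last by rewrite subrr normr0.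
exact: hn.
Unshelve. all: by end_near. Qed.
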